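(* The path-wise Sinkhorn algorithm with nodal capacities (described in the context) converges to the unique optimal plan $\{\pi^{(\mathbf p)}\}_{\mathbf p}$ of the entropically regularized path-wise transport problem $$\min_{\{\pi^{(\mathbf p)}\}}\ \sum_{\mathbf p\in\mathcal P}\Big\langle c^{(\mathbf p)}+\varepsilon\big(\log\pi^{(\mathbf p)}-1\big),\,\pi^{(\mathbf p)}\Big\rangle$$ subject to $$\sum_{\mathbf p\in\mathcal P(v^-)}P_{v^-}(\pi^{(\mathbf p)})=\mu^0(\cdot,v^-),\ v^-\in\mathcal V^-,\qquad \sum_{\mathbf p\in\mathcal P(v^+)}P_{v^+}(\pi^{(\mathbf p)})=\mu^{\mathcal T}(\cdot,v^+),\ v^+\in\mathcal V^+,$$ $$\sum_{\mathbf p\in\mathcal P(v)}P_{v}(\pi^{(\mathbf p)})\le r(\cdot,v)\quad\text{at every intermediate node } v,$$ at a linear rate.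
   Context: Setting. $\mathcal G=(\mathcal V,\mathcal E,\mathcal W)$ is a directed graph with positive edge weights $w$, source nodes $\mathcal V^-\subseteq\mathcal V$ and sink nodes $\mathcal V^+\subseteq\mathcal V$; $\mathcal P$ is a collection of admissible paths from sources to sinks, and $\mathcal P(v)$ is the subset of paths containing the node $v$. For a path $\mathbf p=\{v_0,v_1,\dots,v_{\mathcal T}\}$ (its length may depend on $\mathbf p$) with source $v^-=v_0$ and sink $v^+=v_{\mathcal T}$, $\pi^{(\mathbf p)}$ is a nonnegative plan over the times $(t_0,\{t_\ell\},t_{\mathcal T})$, in $[0,t_f]$ and discretized, at which mass departs from $v^-$, crosses the intermediate nodes $v_\ell$ and arrives at $v^+$; $P_v(\pi^{(\mathbf p)})$ is its marginal at node $v$. The path cost is $c^{(\mathbf p)}=\sum_{\ell=1}^{\mathcal T}w(v_{\ell-1},v_\ell)/(t_\ell-t_{\ell-1})$ for $t_0<t_1<\dots<t_{\mathcal T}$ and $+\infty$ otherwise. The measures $\mu^0(\cdot,v^-)$ and $\mu^{\mathcal T}(\cdot,v^+)$ are given departure and arrival profiles, $r_v=r(\cdot,v)>0$ are given flow-rate bounds, and $\varepsilon>0$ is the regularization parameter. Notation. $\mathbf K^{(\mathbf p)}=\exp(-c^{(\mathbf p)}/\varepsilon)$. The scalings are functions of time: $\mathbf u_{v^-}(t_0)$ for each source, $\mathbf v_{v^+}(t_{\mathcal T})$ for each sink, and $\mathbf w_v(t)$ for each intermediate node (one scaling per node, shared by all paths through it). In products, $v_\ell\in\mathbf p$ ranges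 over the intermediate nodes of $\mathbf p$. Integrals over the discretized times are sums, $\oslash$ and quotients are element-wise, and $\mathbf 1$ is the all-ones function. Path-wise Sinkhorn algorithm with nodal capacities. Initialize $\mathbf u_{v^-}=\mathbf 1$, $\mathbf v_{v^+}=\mathbf 1$, $\mathbf w_v=\mathbf 1$. While not converged, repeat: (a) Compute the flux profiles along each path $\mathbf p$: $$A^{(\mathbf p)}_{v^-}(t_0)=\int_{\{t_\ell\},t_{\mathcal T}}\mathbf K^{(\mathbf p)}\Big(\prod_{v_\ell\in\mathbf p}\mathbf w_{v_\ell}(t_\ell)\Big)\mathbf v_{v^+}(t_{\mathcal T}),\qquad A^{(\mathbf p)}_{v^+}(t_{\mathcal T})=\int_{t_0,\{t_\ell\}}\mathbf K^{(\mathbf p)}\mathbf u_{v^-}(t_0)\Big(\prod_{v_\ell\in\mathbf p}\mathbf w_{v_\ell}(t_\ell)\Big),$$ $$A^{(\mathbf p)}_{v_\ell}(t_\ell)=\int_{t_0,\{t_{\ell'}\}_{\ell'\ne\ell},t_{\mathcal T}}\mathbf K^{(\mathbf p)}\mathbf u_{v^-}(t_0)\mathbf v_{v^+}(t_{\mathcal T})\prod_{v_{\ell'}\in\mathbf p,\ \ell'\ne\ell}\mathbf w_{v_{\ell'}}(t_{\ell'}).$$ (b) Aggregate the marginals at the nodes, $$m_{v^-}=\sum_{\mathbf p\in\mathcal P(v^-)}\mathbf u_{v^-}A^{(\mathbf p)}_{v^-},\qquad m_{v^+}=\sum_{\mathbf p\in\mathcal P(v^+)}\mathbf v_{v^+}A^{(\mathbf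 p)}_{v^+},\qquad m_v=\sum_{\mathbf p\in\mathcal P(v)}\mathbf w_vA^{(\mathbf p)}_v,$$ and compute the departure–arrival projections $$\mathbf u_{v^-}\leftarrow\frac{\mu^0(\cdot,v^-)}{m_{v^-}},\qquad \mathbf v_{v^+}\leftarrow\frac{\mu^{\mathcal T}(\cdot,v^+)}{m_{v^+}}.$$ (c) Compute the capacity projection at each node $v$: $\mathbf w_v\leftarrow\min\{r_v\oslash m_v,\ \mathbf 1\}$. After the loop, the plan for each path is $\pi^{(\mathbf p)}=\mathbf K^{(\mathbf p)}\,\mathbf u_{v^-}(t_0)\big(\prod_{v_\ell\in\mathbf p}\mathbf w_{v_\ell}(t_\ell)\big)\mathbf v_{v^+}(t_{\mathcal T})$.
   Formalization: Updates multiply the current scaling by the ratio (u←u·μ⁰/m, v←v·μᵀ/m, w←min(w·r/m,1)), done in sequence (u, v, then node by node) with m recomputed; assumes a feasible plan positive exactly on finite-cost schedules with charged endpoints. As written, it can diverge or converge sublinearly. *)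

(* Defs.v *)
From mathcomp Require Import all_boot all_order all_algebra finmap.
From mathcomp Require Import all_classical all_reals all_analysis.

Set Implicit Arguments.
Unset Strict Implicit.
Unset Printing Implicit Defensive.

Import Order.TTheory GRing.Theory Num.Theory.
Local Open Scope ring_scope.

(* A node sequence v_0, ..., v_(n.+1) with n intermediate nodes; thus it always
   has at least one edge, its source is at [ord0] and its sink at [ord_max]. *)
Definition route (V : choiceType) := {n : nat & n.+2.-tuple V}.

Definition pos (V : choiceType) (p : route V) := 'I_(tag p).+2.

Definition vertex (V : choiceType) (p : route V) (l : pos p) : V :=
  tnth (tagged p) l.

Definition src (V : choiceType) (p : route V) : V := vertex (ord0 : pos p).
Definition snk (V : choiceType) (p : route V) : V := vertex (ord_max : pos p).

Definition inner (V : choiceType) (p : route V) (l : pos p) : bool :=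
  (l != ord0) && (l != ord_max).

(* Indices (in a grid of N times) of the times t_0, ..., t_(n.+1) at which mass
   is at the successive nodes of p. *)
Definition schedule (V : choiceType) (N : nat) (p : route V) :=
  {ffun 'I_(tag p).+2 -> 'I_N}.

(* Paths have no repeated nodes, so a path crosses a given node at one time. *)
Definition is_route (V : finType) (edge : rel V) (S T : {set V})
    (p : route V) : bool :=
  [&& src p \in S, snk p \in T, sorted edge (tagged p) & uniq (tagged p)].

Record network (R : realType) := Network {
  node : finType;
  edge : rel node;
  weight : node -> node -> R;
  weight_gt0 : forall x y, edge x y -> 0 < weight x y;
  sources : {set node};
  sinks : {set node};
  routes : {fset route node};
  routesP : forall p, p \in routes -> is_route edge sources sinks p;
  horizon : R;
  ntimes : nat;
  time : 'I_ntimes -> R;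
  time_incr : forall i j : 'I_ntimes, (i < j)%N -> time i < time j;
  time_range : forall i, 0 <= time i <= horizon;
  mu0 : 'I_ntimes -> node -> R;
  muT : 'I_ntimes -> node -> R;
  mu0_ge0 : forall i x, x \in sources -> 0 <= mu0 i x;
  muT_ge0 : forall i x, x \in sinks -> 0 <= muT i x;
  rate : 'I_ntimes -> node -> R;
  rate_gt0 : forall i x, 0 < rate i x;
  eps : R;
  eps_gt0 : 0 < eps }.

Section Problem.
Variables (R : realType) (G : network R).

Definition plan := forall p : routes G, schedule (ntimes G) (val p) -> R.

Definition path_cost (p : route (node G)) (t : schedule (ntimes G) p) : \bar R :=
  let v (l : 'I_(tag p).+2) := vertex (l : pos p) in
  let tau (l : 'I_(tag p).+2) := time (t l) in
  let prev (l : 'I_(tag p).+1) := widen_ord (leqnSn _) l in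
  let next (l : 'I_(tag p).+1) := lift ord0 l in
  if [forall l, tau (prev l) < tau (next l)] then
    (\sum_l weight (v (prev l)) (v (next l)) / (tau (next l) - tau (prev l)))%:E
  else +oo%E.

(* The marginal at the l-th node of p. *)
Definition marginal (p : route (node G)) (pi : schedule (ntimes G) p -> R)
    (l : pos p) (i : 'I_(ntimes G)) : R :=
  \sum_(t : schedule (ntimes G) p | t l == i) pi t.

(* At a source (sink) only the paths departing from (arriving at) it are
   counted; the marginals of paths having it as an intermediate node, if any,
   enter [crossings]. *)
Definition departures (pi : plan) (x : node G) (i : 'I_(ntimes G)) : R :=
  \sum_(p : routes G | src (val p) == x) marginal (pi p) ord0 i.

Definition arrivals (pi : plan) (x : node G) (i : 'I_(ntimes G)) : R :=
  \sum_(p : routes G | snk (val p) == x) marginal (pi p) ord_max i.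

(* By uniqueness of the nodes of p, the sum over l has at most one term. *)
Definition crossings (pi : plan) (x : node G) (i : 'I_(ntimes G)) : R :=
  \sum_(p : routes G) \sum_(l : pos (val p) | inner l && (vertex l == x))
     marginal (pi p) l i.

Definition feasible (pi : plan) : Prop :=
  [/\ forall p t, 0 <= pi p t,
      forall x i, x \in sources G -> departures pi x i = mu0 i x,
      forall x i, x \in sinks G -> arrivals pi x i = muT i x &
      forall x i, crossings pi x i <= rate i x].

(* [ln 0 = 0] and [+oo * 0 = 0], so entries with no mass contribute 0. *)
Definition objective (pi : plan) : \bar R :=
  (\sum_(p : routes G) \sum_(t : schedule (ntimes G) (val p))
     (path_cost t + (eps G * (ln (pi p t) - 1))%:E) * (pi p t)%:E)%E.

Definition optimal (pi : plan) : Prop :=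
  feasible pi /\
  forall pi', feasible pi' -> (objective pi <= objective pi')%E.

(* Slater condition: some feasible plan charges every schedule of finite cost
   whose endpoints are charged by the prescribed profiles (and no other one).
   Feasibility alone does not give a linear rate: for a single edge with times
   0 < 1 < 2, departures (1/2, 1/2, 0) and arrivals (0, 1/2, 1/2), the feasible
   plan is unique, vanishes at the finite-cost schedule 0 -> 2, and the
   Sinkhorn iterates converge to it only sublinearly. *)
Definition strictly_feasible : Prop :=
  exists2 pi : plan, feasible pi &
    forall (p : routes G) t,
      (0 < pi p t) =
      [&& (path_cost t < +oo)%E,
          0 < mu0 (t ord0) (src (val p)) & 0 < muT (t ord_max) (snk (val p))].

Definition gibbs (p : route (node G)) (t : schedule (ntimes G) p) : R :=
  fine (expeR (- (path_cost t * ((eps G)^-1)%:E))%E).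

Record scaling := Scaling {
  su : node G -> 'I_(ntimes G) -> R;
  sv : node G -> 'I_(ntimes G) -> R;
  sw : node G -> 'I_(ntimes G) -> R }.

Definition init_scaling : scaling :=
  Scaling (fun _ _ => 1) (fun _ _ => 1) (fun _ _ => 1).

Definition scaled_plan (s : scaling) : plan := fun p t =>
  gibbs t * su s (src (val p)) (t ord0)
  * (\prod_(l : pos (val p) | inner l) sw s (vertex l) (t l))
  * sv s (snk (val p)) (t ord_max).

Definition flux_src (s : scaling) (p : route (node G)) (i : 'I_(ntimes G)) : R :=
  \sum_(t : schedule (ntimes G) p | t ord0 == i)
    gibbs t * (\prod_(l : pos p | inner l) sw s (vertex l) (t l))
    * sv s (snk p) (t ord_max).

Definition flux_snk (s : scaling) (p : route (node G)) (i : 'I_(ntimes G)) : R :=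
  \sum_(t : schedule (ntimes G) p | t ord_max == i)
    gibbs t * su s (src p) (t ord0)
    * (\prod_(l : pos p | inner l) sw s (vertex l) (t l)).

Definition flux_inner (s : scaling) (p : route (node G)) (l : pos p)
    (i : 'I_(ntimes G)) : R :=
  \sum_(t : schedule (ntimes G) p | t l == i)
    gibbs t * su s (src p) (t ord0) * sv s (snk p) (t ord_max)
    * (\prod_(l' : pos p | inner l' && (l' != l)) sw s (vertex l') (t l')).

Definition mass_src (s : scaling) (x : node G) (i : 'I_(ntimes G)) : R :=
  \sum_(p : routes G | src (val p) == x) su s x i * flux_src s (val p) i.

Definition mass_snk (s : scaling) (x : node G) (i : 'I_(ntimes G)) : R :=
  \sum_(p : routes G | snk (val p) == x) sv s x i * flux_snk s (val p) i.

Definition mass_inner (s : scaling) (x : node G) (i : 'I_(ntimes G)) : R :=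
  \sum_(p : routes G) \sum_(l : pos (val p) | inner l && (vertex l == x))
     sw s x i * flux_inner s l i.

(* The masses are the marginals of the current plan, own scaling included, so
   the ratio prescribed / current is the factor by which the projection
   corrects the current scaling.  Overwriting the scaling by that ratio alone
   would not be a projection: for one edge with a single finite-cost schedule it
   in general makes the plan cycle.  Likewise each projection is computed from the
   scalings as last updated; evaluating both endpoint projections from the same
   old scalings makes the plan oscillate in that example. *)
Definition project_src (s : scaling) : scaling :=
  Scaling (fun x i => su s x i * (mu0 i x / mass_src s x i)) (sv s) (sw s).

Definition project_snk (s : scaling) : scaling :=
  Scaling (su s) (fun x i => sv s x i * (muT i x / mass_snk s x i)) (sw s).

(* The quotient rate / 0 is read as +oo, so the minimum is then 1. *)
Definition project_capacity (s : scaling) (x : node G) : scaling :=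
  Scaling (su s) (sv s)
    (fun y i => if y == x then
                  if mass_inner s x i == 0 then 1
                  else Num.min (sw s x i * (rate i x / mass_inner s x i)) 1
                else sw s y i).

(* One pass of the loop; the capacity projections are performed node after node
   in the order given by [nodes]. *)
Definition sweep (nodes : seq (node G)) (s : scaling) : scaling :=
  foldl project_capacity (project_snk (project_src s)) nodes.

Definition sinkhorn_plan (nodes : seq (node G)) (k : nat) : plan :=
  scaled_plan (iter k (sweep nodes) init_scaling).

Definition converges_linearly (x : nat -> plan) (y : plan) : Prop :=
  exists C rho : R, [/\ 0 <= C, 0 < rho < 1 &
    forall k p t, `|x k p t - y p t| <= C * rho ^+ k].

End Problem.

(* Main.v *)
Require Import Defs.
From mathcomp Require Import all_boot all_order all_algebra finmap.
From mathcomp Require Import all_classical all_reals all_analysis.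
From mathcomp Require Import ring lra.

Set Implicit Arguments.
Unset Strict Implicit.
Unset Printing Implicit Defensive.

Import Order.TTheory GRing.Theory Num.Theory.
Import numFieldNormedType.Exports.
Local Open Scope ring_scope.

(** In logarithmic coordinates the algorithm is cyclic block coordinate ascent
    on the dual of the entropic problem, the multipliers of the capacity
    constraints being nonpositive.  The blocks consist of constraints with
    disjoint supports, so each projection is an exact maximization.

    Pairing the dual with the strictly positive feasible plan shows that the
    potentials of the iterates stay in a compact set, where the dual is strongly
    concave as a function of the potential; hence a sweep increases the dual by
    at least a multiple of the squared length of its step.  Conversely, at the
    end of a sweep the optimality conditions hold up to the length of the step.
    The dual is not coercive in the multipliers, but Hoffman's error bound allows
    any later iterate to be replaced by multipliers with the same potential and
    the same linear term at a distance controlled by the gaps in these, so that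
    the remaining dual gap is at most a multiple of the squared step.  The two
    estimates make the gap contract geometrically; the multipliers then converge
    geometrically to a solution of the optimality conditions. *)

(** * Hoffman's error bound *)

Lemma choice2 (X Y : Type) (P Q : X -> Y -> Prop) :
  (forall x, exists2 y, P x y & Q x y) ->
  exists f : X -> Y, forall x, P x (f x) /\ Q x (f x).
Proof.
move=> PQ; have [|f fP] := @choice _ _ (fun x y => P x y /\ Q x y).
  by move=> x; have [y ? ?] := PQ x; exists y.
by exists f.
Qed.

Section ErrorBound.
Context {R : realType} {I J : finType}.
Implicit Types (M : I -> J -> R) (x y : I -> R) (S : {set I}).

Definition residual M x := \sum_j `|\sum_i x i * M i j|.

Lemma residual_ge0 M x : 0 <= residual M x.
Proof. by apply: sumr_ge0 => j _; exact: normr_ge0. Qed.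

Lemma residualZ M x (c : R) : residual M (fun i => c * x i) = `|c| * residual M x.
Proof.
rewrite /residual mulr_sumr; apply: eq_bigr => j _.
by rewrite -normrM mulr_sumr; congr `|_|; apply: eq_bigr => i _; rewrite mulrA.
Qed.

Lemma residual_eq0 M x : residual M x = 0 -> forall j, \sum_i x i * M i j = 0.
Proof.
move=> h j; apply/eqP; rewrite -normr_eq0; apply/eqP.
by apply: (psumr_eq0P _ h) => // k _; exact: normr_ge0.
Qed.

Lemma continuous_residual M :
  continuous (fun v : 'rV[R]_#|I| => residual M (fun i => v ord0 (enum_rank i))).
Proof.
move=> v; have FF : Filter (nbhs v) by exact: nbhs_filter.
apply: cvg_big => [|j _]; first exact: add_continuous.
apply: cvg_norm; apply: cvg_big => [|i _]; first exact: add_continuous.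
by apply: cvgMl; exact: coord_continuous.
Qed.

Lemma max_coord_le_residual M S (i0 : I) :
  (forall x, (forall i, 0 <= x i) -> (forall i, i \notin S -> x i = 0) ->
     residual M x = 0 -> x i0 = 0) ->
  exists2 k : R, 0 <= k & forall x,
    (forall i, 0 <= x i) -> (forall i, i \notin S -> x i = 0) ->
    (forall i, x i <= x i0) -> x i0 <= k * residual M x.
Proof.
move=> ker0; have [i0S|i0S] := boolP (i0 \in S); last first.
  by exists 0 => // x _ xS _; rewrite xS // mul0r.
pose lo i : R := (i == i0)%:R; pose hi i : R := (i \in S)%:R.
have lohi i : lo i <= hi i.
  by rewrite /lo /hi; case: eqP => [->|_]; rewrite ?i0S // ler0n.
pose K := [set v : 'rV[R]_#|I| |
  forall i, `[lo (enum_val i), hi (enum_val i)]%classic (v ord0 i)]%classic.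
have K0 : (K !=set0)%classic.
  exists (\row_i hi (enum_val i)) => i /=.
  by rewrite mxE in_itv /= lohi lexx.
have cK : compact K.
  by apply: (@rV_compact _ _ (fun i => `[lo (enum_val i), hi (enum_val i)]%classic))
    => i; exact: segment_compact.
have [c cin cmin] := EVT_min_rV K0 cK
  (continuous_subspaceT (@continuous_residual M)).
rewrite inE in cin; set fc := residual _ _ in cmin.
have c_ge i : lo i <= c ord0 (enum_rank i) <= hi i.
  by have := cin (enum_rank i); rewrite /= in_itv /= enum_rankK.
have fc_gt0 : 0 < fc.
  rewrite lt_def residual_ge0 andbT; apply/eqP => fc0.
  have := ker0 (fun i => c ord0 (enum_rank i)).
  have /andP[+ _] := c_ge i0; rewrite /lo eqxx => c1 h.
  suff c0 : c ord0 (enum_rank i0) = 0 by move: c1; rewrite c0 ler10.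
  apply: h => // i.
    by have /andP[+ _] := c_ge i; apply: le_trans; exact: ler0n.
  move=> iS; have := c_ge i; rewrite /lo /hi (negbTE iS).
  case: eqP iS => [->|_ _]; first by rewrite i0S.
  by move=> /andP[? ?]; apply/eqP; rewrite eq_le; apply/andP.
exists fc^-1 => [|x x0 xS xmax]; first by rewrite invr_ge0 ltW.
have [->|xi0] := eqVneq (x i0) 0.
  by rewrite mulr_ge0 ?residual_ge0 // invr_ge0 ltW.
have {}xi0 : 0 < x i0 by rewrite lt_def xi0 x0.
have := cmin (\row_i ((x i0)^-1 * x (enum_val i))).
have -> : residual M (fun i => (\row_k ((x i0)^-1 * x (enum_val k))) ord0 (enum_rank i))
   = (x i0)^-1 * residual M x.
  have -> : (x i0)^-1 = `|(x i0)^-1| by rewrite gtr0_norm // invr_gt0.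
  rewrite -residualZ; congr residual; apply: funext => i.
  by rewrite mxE enum_rankK gtr0_norm ?invr_gt0.
rewrite inE => h; rewrite ler_pdivlMl // mulrC -ler_pdivlMl //; apply: h.
move=> i; rewrite /= mxE in_itv /=; set k := enum_val i.
apply/andP; split.
  rewrite /lo; case: eqP => [->|_]; first by rewrite mulVf ?gt_eqF.
  by rewrite mulr_ge0 // invr_ge0 ltW.
rewrite /hi; case: (boolP (k \in S)) => kS; last by rewrite (xS k) ?mulr0.
by rewrite ler_pdivrMl // mulr1.
Qed.

Lemma nonneg_sum_le_residual M S :
  (forall x, (forall i, 0 <= x i) -> (forall i, i \notin S -> x i = 0) ->
     residual M x = 0 -> forall i, x i = 0) ->
  exists2 k : R, 0 <= k & forall x,
    (forall i, 0 <= x i) -> (forall i, i \notin S -> x i = 0) ->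
    \sum_i x i <= k * residual M x.
Proof.
move=> ker0.
have [k kP] := choice2 (fun i0 =>
  max_coord_le_residual (fun x a b c => ker0 x a b c i0)).
have k0 i : 0 <= k i by case: (kP i).
exists (#|I|%:R * \sum_i k i) => [|x x0 xS].
  by rewrite mulr_ge0 ?ler0n // sumr_ge0.
have [i1 _|I0] := pickP (@predT I); last first.
  by rewrite !big_pred0 // mulr0 mul0r.
pose i0 := [arg max_(i > i1) x i]%O.
have xmax i : x i <= x i0 by rewrite /i0; case: arg_maxP => // j _; exact.
apply: (@le_trans _ _ (\sum_(i : I) x i0)); first exact: ler_sum.
rewrite sumr_const -[X in X <= _]mulr_natl -mulrA ler_wpM2l ?ler0n //.
apply: (le_trans ((kP i0).2 x x0 xS xmax)).
by rewrite ler_wpM2r ?residual_ge0 // (bigD1 i0) //= lerDl sumr_ge0.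
Qed.

(* A nonnegative kernel vector can be subtracted until a coordinate vanishes;
   once there is none left, compactness applies. *)
Lemma nonneg_error_bound M : exists2 k : R, 0 <= k & forall x,
  (forall i, 0 <= x i) -> exists y,
  [/\ forall i, 0 <= y i <= x i,
      forall j, \sum_i y i * M i j = \sum_i x i * M i j &
      \sum_i y i <= k * residual M x].
Proof.
suff H n : forall S, #|S| = n -> exists2 k : R, 0 <= k & forall x,
    (forall i, 0 <= x i) -> (forall i, i \notin S -> x i = 0) -> exists y,
  [/\ forall i, 0 <= y i <= x i,
      forall j, \sum_i y i * M i j = \sum_i x i * M i j &
      \sum_i y i <= k * residual M x].
  have [k k0 kP] := H _ [set: I]%SET erefl; exists k => // x x0.
  by apply: kP => // i; rewrite inE.
elim: n => [|n IH] S cS.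
  exists 0 => // x x0 xS; exists x; split => // [i|].
    by rewrite x0 lexx.
  by rewrite mul0r big1 // => i _; apply: xS; rewrite (cards0_eq cS) inE.
have [ker0|] := pselect (forall x, (forall i, 0 <= x i) ->
    (forall i, i \notin S -> x i = 0) -> residual M x = 0 -> forall i, x i = 0).
  have [k k0 kP] := nonneg_sum_le_residual ker0; exists k => // x x0 xS.
  by exists x; split => // [i|]; [rewrite x0 lexx|exact: kP].
move=> /existsNP[e] /not_implyP[e0] /not_implyP[eS] /not_implyP[Me].
move=> /existsNP[i1] /eqP ei1.
have {}ei1 : 0 < e i1 by rewrite lt_def ei1 e0.
have {}Me := residual_eq0 Me.
have IH' (i : I) : exists2 k : R, 0 <= k & (i \in S -> forall x,
    (forall i', 0 <= x i') -> (forall i', i' \notin S :\ i -> x i' = 0) -> exists y,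
    [/\ forall i, 0 <= y i <= x i,
        forall j, \sum_i y i * M i j = \sum_i x i * M i j &
        \sum_i y i <= k * residual M x]).
  have [iS|] := boolP (i \in S); last by exists 0.
  have [|k k0 kP] := IH (S :\ i); last by exists k.
  by move: cS; rewrite (cardsD1 i) iS => -[].
have [k kP] := choice2 IH'; have k0 i : 0 <= k i by case: (kP i).
exists (\sum_i k i) => [|x x0 xS]; first exact: sumr_ge0.
pose i0 := [arg min_(i < i1 | 0 < e i) (x i / e i)]%O.
have [ei0 tmin] : 0 < e i0 /\ forall i, 0 < e i -> x i0 / e i0 <= x i / e i.
  by rewrite /i0; case: arg_minP.
set t := x i0 / e i0 in tmin.
have t0 : 0 <= t by rewrite divr_ge0 // ltW.
have i0S : i0 \in S by apply: contraTT ei0 => /eS ->; rewrite ltxx.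
pose x' i := x i - t * e i.
have x'0 i : 0 <= x' i.
  rewrite subr_ge0; have [ei|] := ltP 0 (e i).
    by rewrite -ler_pdivlMr // tmin.
  by move=> ei; have -> : e i = 0 by [apply/eqP; rewrite eq_le ei e0]; rewrite mulr0.
have x'S i : i \notin S :\ i0 -> x' i = 0.
  rewrite !inE negb_and negbK => /orP[/eqP ->|iS].
    by rewrite /x' /t divfK ?subrr // gt_eqF.
  by rewrite /x' xS // eS // mulr0 subrr.
have Mx' j : \sum_i x' i * M i j = \sum_i x i * M i j.
  under eq_bigr => i _ do rewrite /x' mulrBl -mulrA.
  by rewrite sumrB -mulr_sumr Me mulr0 subr0.
have [y [y0 yM yk]] := (kP i0).2 i0S x' x'0 x'S; exists y; split.
- move=> i; have /andP[-> /= yx] := y0 i; apply: (le_trans yx).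
  by rewrite gerBl mulr_ge0.
- by move=> j; rewrite yM Mx'.
- apply: (le_trans yk); have -> : residual M x' = residual M x.
    by apply: eq_bigr => j _; rewrite Mx'.
  by rewrite ler_wpM2r ?residual_ge0 // (bigD1 i0) //= lerDl sumr_ge0.
Qed.

(* The conclusion keeps [y] in the box spanned by [x] and [z], so sign
   constraints on the multipliers survive. *)
Lemma hoffman_error_bound M : exists2 k : R, 0 <= k & forall x z, exists y,
  [/\ forall i, Num.min (x i) (z i) <= y i <= Num.max (x i) (z i),
      forall j, \sum_i y i * M i j = \sum_i z i * M i j &
      \sum_i `|y i - x i| <= k * residual M (fun i => z i - x i)].
Proof.
pose sg (s : {ffun I -> bool}) i : R := (-1) ^+ s i.
have [k kP] := choice2 (fun s : {ffun I -> bool} =>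
  nonneg_error_bound (fun i j => sg s i * M i j)).
have k0 s : 0 <= k s by case: (kP s).
exists (\sum_s k s) => [|x z]; first exact: sumr_ge0.
pose s := [ffun i => z i < x i].
have sgE i : z i - x i = sg s i * `|z i - x i|.
  rewrite /sg ffunE; have [zx|zx] := ltP (z i) (x i).
    by rewrite expr1 mulN1r ltr0_norm ?subr_lt0 // opprK.
  by rewrite expr0 mul1r ger0_norm // subr_ge0.
have [|d [d0 dM dk]] := (kP s).2 (fun i => `|z i - x i|).
  by move=> i; exact: normr_ge0.
have dMz j : \sum_i (sg s i * d i) * M i j = \sum_i (z i - x i) * M i j.
  transitivity (\sum_i d i * (sg s i * M i j)).
    by apply: eq_bigr => i _; ring.
  by rewrite dM; apply: eq_bigr => i _; rewrite {2}sgE; ring.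
exists (fun i => x i + sg s i * d i); split.
- move=> i; have := d0 i; rewrite /sg ffunE; have [zx|zx] := ltP (z i) (x i).
    rewrite ltr0_norm ?subr_lt0 //=.
    by move=> /andP[? ?]; rewrite expr1 mulN1r; apply/andP; split; lra.
  rewrite ger0_norm ?subr_ge0 //=.
  by move=> /andP[? ?]; rewrite expr0 mul1r; apply/andP; split; lra.
- move=> j; under eq_bigr => i _ do rewrite mulrDl.
  rewrite big_split /= dMz -big_split /=.
  by apply: eq_bigr => i _; ring.
- have -> : \sum_i `|x i + sg s i * d i - x i| = \sum_i d i.
    apply: eq_bigr => i _; have /andP[? _] := d0 i.
    by rewrite addrAC subrr add0r normrM normr_sign mul1r ger0_norm.
  apply: (le_trans dk); have -> : residual (fun i j => sg s i * M i j)
     (fun i => `|z i - x i|) = residual M (fun i => z i - x i).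
    by apply: eq_bigr => j _; congr `|_|; apply: eq_bigr => i _; rewrite {2}sgE; ring.
  by rewrite ler_wpM2r ?residual_ge0 // (bigD1 s) //= lerDl sumr_ge0.
Qed.

End ErrorBound.

(** * Estimates for the exponential and geometric sequences *)

Section RealEstimates.
Context {R : realType}.
Implicit Types x y L : R.

Lemma expR_half_sqr x : expR x = expR (x / 2) ^+ 2.
Proof. by rewrite expr2 -expRD; congr expR; lra. Qed.

Lemma expR_quadratic_lower x L : `|x| <= L ->
  expR (- L) / 4 * x ^+ 2 <= expR x - 1 - x.
Proof.
move=> xL; set s := expR (x / 2).
have s1 : 1 + x / 2 <= s by exact: expR_ge1Dx.
have s0 : 0 < s by exact: expR_gt0.
have hs : (s - 1) ^+ 2 <= expR x - 1 - x.
  by rewrite expR_half_sqr -/s expr2; nra.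
apply: (le_trans _ hs).
have [x0|x0] := leP 0 x.
  have eL : expR (- L) <= 1.
    by rewrite -expR0 ler_expR oppr_le0 (le_trans _ xL).
  apply: (@le_trans _ _ ((x / 2) ^+ 2)).
    by have := sqr_ge0 x; rewrite !expr2; nra.
  by rewrite !expr2; nra.
have eL : expR (- L) <= s ^+ 2.
  rewrite -expR_half_sqr ler_expR lerNl; move: xL; rewrite ltr0_norm //.
have s2 : s * expR (- x / 2) = 1 by rewrite -expRD -[RHS]expR0; congr expR; lra.
have s3 : 1 + - x / 2 <= expR (- x / 2) by exact: expR_ge1Dx.
have s4 : s * (- x / 2) <= 1 - s by nra.
have s5 : 0 <= s * (- x / 2) by rewrite mulr_ge0 ?ltW //; lra.
apply: (@le_trans _ _ ((s * (- x / 2)) ^+ 2)).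
  by rewrite exprMn; have := sqr_ge0 x; rewrite !expr2; nra.
by rewrite -[leRHS]sqrrN lerXn2r ?nnegrE //; lra.
Qed.

Lemma expR_lipschitz x y L : x <= L -> y <= L ->
  `|expR x - expR y| <= expR L * `|x - y|.
Proof.
wlog yx : x y / y <= x => [hw xL yL|xL yL].
  have [yx|/ltW xy] := leP y x; first exact: hw.
  by rewrite distrC [X in _ * X]distrC; exact: hw.
have exy : expR y <= expR x by rewrite ler_expR.
rewrite ger0_norm ?subr_ge0 // ger0_norm ?subr_ge0 //.
have -> : expR x - expR y = expR x * (1 - expR (y - x)).
  by rewrite mulrBr mulr1 -expRD (addrC x) subrK.
apply: ler_pM; rewrite ?expR_ge0 ?ler_expR //.
  by rewrite subr_ge0 -expR0 ler_expR subr_le0.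
by have := @expR_ge1Dx R (y - x); lra.
Qed.

Lemma expR_affine_lower k s : 0 < k -> 0 < s ->
  exists c : R, forall x, c <= k * expR x - s * x.
Proof.
move=> k0 s0; exists (s * (1 - ln (s / k))) => x.
have -> : k * expR x = s * expR (x - ln (s / k)).
  rewrite expRD expRN lnK ?posrE ?divr_gt0 // invf_div.
  by field; rewrite !gt_eqF.
by have := @expR_ge1Dx R (x - ln (s / k)); nra.
Qed.

Lemma expR_affine_coercive k s B : 0 < k -> 0 < s ->
  exists L : R, forall x, k * expR x - s * x <= B -> `|x| <= L.
Proof.
move=> k0 s0.
have [c2 h2] := expR_affine_lower k0 (mulr_gt0 (ltr0n R 2) s0).
have [c1 h1] := expR_affine_lower k0 (divr_gt0 s0 (ltr0n R 2)).
exists (Num.max ((B - c2) / s) (2 * (B - c1) / s)) => x hx.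
rewrite le_max !ler_norml.
apply/orP; have [x0|x0] := leP 0 x; [left|right].
- have : x <= (B - c2) / s by rewrite ler_pdivlMr //; have := h2 x; nra.
  by move=> ?; apply/andP; split => //; lra.
- have : - x <= 2 * (B - c1) / s by rewrite ler_pdivlMr //; have := h1 x; nra.
  by move=> ?; apply/andP; split => //; lra.
Qed.

Lemma le0_of_geometric x C r : 0 <= r < 1 ->
  (forall k, x <= C * r ^+ k) -> x <= 0.
Proof.
move=> /andP[r0 r1] h; have cr : (geometric C r n @[n --> \oo] --> (0 : R))%classic.
  by apply: cvg_geometric; rewrite ger0_norm.
rewrite -(cvg_lim (@Rhausdorff R) cr); apply: limr_ge.
  by apply: cvgP cr.
by near=> k; exact: h.
Unshelve. all: by end_near. Qed.

Lemma geometric_cauchy (u : nat -> R) C r : 0 <= r < 1 ->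
  (forall k, `|u k.+1 - u k| <= C * r ^+ k) ->
  exists l, forall k, `|u k - l| <= C / (1 - r) * r ^+ k.
Proof.
move=> /andP[r0 r1] h; have r1' : 0 < 1 - r by lra.
set B := C / (1 - r); have BC : C = B * (1 - r) by rewrite /B divfK ?gt_eqF.
have C0 : 0 <= C by have := h 0%N; rewrite expr0 mulr1; apply: le_trans.
have B0 : 0 <= B by rewrite divr_ge0 // ltW.
have lo k : u k - B * r ^+ k <= u k.+1 - B * r ^+ k.+1.
  by have := h k; rewrite ler_norml BC exprS; set p := r ^+ k => /andP[+ _]; lra.
have hi k : u k.+1 + B * r ^+ k.+1 <= u k + B * r ^+ k.
  by have := h k; rewrite ler_norml BC exprS; set p := r ^+ k => /andP[_]; lra.
have lo_mono : {homo (fun k => u k - B * r ^+ k) : m n / (m <= n)%N >-> m <= n}.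
  by apply: homo_leq => [?|? ? ?|//]; [exact: lexx|exact: le_trans].
have hi_mono : {homo (fun k => u k + B * r ^+ k) : m n / (m <= n)%N >-> n <= m}.
  by apply: homo_leq => [?|? ? ? ab bc|//]; [exact: lexx|exact: le_trans bc ab].
have B_ge0 k : 0 <= B * r ^+ k by rewrite mulr_ge0 // exprn_ge0.
have lohi m n : u m - B * r ^+ m <= u n + B * r ^+ n.
  apply: (le_trans (lo_mono _ _ (leq_maxl m n))).
  apply: (le_trans _ (hi_mono _ _ (leq_maxr m n))).
  by have := B_ge0 (maxn m n); lra.
pose S := [set u k - B * r ^+ k | k in setT]%classic.
have supS : has_sup S.
  split; first by exists (u 0%N - B * r ^+ 0), 0%N.
  by exists (u 0%N + B * r ^+ 0) => _ [k _ <-].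
exists (sup S) => k.
have : u k - B * r ^+ k <= sup S by apply: sup_upper_bound => //; exists k.
have : sup S <= u k + B * r ^+ k.
  by apply: ge_sup; [case: supS|move=> _ [m _ <-]].
by rewrite ler_norml; set p := B * _ => ? ?; apply/andP; split; lra.
Qed.

Lemma geometric_gap (d : nat -> R) c G : 0 < c ->
  (forall k n, (k < n)%N -> d n - d k.+1 <= c * (d k.+1 - d k)) ->
  (forall n, d n - d 0%N <= G) ->
  forall k n, (k <= n)%N -> d n - d k <= G * (c / (1 + c)) ^+ k.
Proof.
move=> c0 h hG; elim=> [|k IH] n kn; first by rewrite expr0 mulr1.
have := IH n (ltnW kn); have := h k n kn; rewrite exprS.
set p := _ ^+ k; set q := c / (1 + c).
have qE : q * (1 + c) = c by rewrite /q divfK // gt_eqF //; lra.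
have q0 : 0 < q by rewrite /q divr_gt0 //; lra.
move=> h1 h2; apply: (@le_trans _ _ (q * (d n - d k))).
  suff : (1 + c) * (d n - d k.+1) <= (1 + c) * (q * (d n - d k)).
    by rewrite ler_pM2l //; lra.
  by rewrite mulrA (mulrC _ q) qE; lra.
by rewrite mulrCA ler_pM2l.
Qed.

Lemma finite_pos_lower (T : finType) (f : T -> R) :
  (forall t, 0 < f t) -> exists2 c, 0 < c & forall t, c <= f t.
Proof.
move=> f0; exists (\big[Num.min/1]_t f t); last by move=> t; exact: bigmin_le.
by apply: lt_bigmin.
Qed.

Lemma finite_upper (T : finType) (f : T -> R) :
  exists2 c, 0 <= c & forall t, f t <= c.
Proof.
exists (\sum_t `|f t|) => [|t]; first by apply: sumr_ge0 => t _; exact: normr_ge0.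
rewrite (bigD1 t) //= (le_trans (ler_norm _)) // lerDl.
by apply: sumr_ge0 => s _; exact: normr_ge0.
Qed.

End RealEstimates.

(** * Duality for entropic problems with linear constraints *)

Section EntropicDuality.
Context {R : realType} {A J : finType}.
Variables (a : J -> A -> bool) (K : A -> R) (b : J -> R) (e : pred J).
Implicit Types (l : J -> R) (x : A -> R).

Definition potential l (s : A) := \sum_j l j * (a j s)%:R.
Definition gibbs_plan l (s : A) := K s * expR (potential l s).
Definition load x (j : J) := \sum_s (a j s)%:R * x s.
Definition dual_value l := \sum_j b j * l j - \sum_s gibbs_plan l s.

(* [e] selects the equality constraints; the multiplier of an inequality
   constraint is nonpositive. *)
Definition admissible l := forall j, ~~ e j -> l j <= 0.

(* First-order optimality of [dual_value] along the [j]-th coordinate, written as a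
   variational inequality: it stays meaningful under limits and perturbations,
   unlike the complementarity conditions to which it is equivalent. *)
Definition stationary l j := forall z, (~~ e j -> z <= 0) ->
  (z - l j) * (b j - load (gibbs_plan l) j) <= 0.

Lemma sum_mul_load l x : \sum_j l j * load x j = \sum_s potential l s * x s.
Proof.
under eq_bigr => j _ do rewrite mulr_sumr.
rewrite exchange_big /=; apply: eq_bigr => s _.
by rewrite mulr_suml; apply: eq_bigr => j _; rewrite mulrA.
Qed.

Lemma potentialB l l' s :
  potential (fun j => l j - l' j) s = potential l s - potential l' s.
Proof. by rewrite -sumrB; apply: eq_bigr => j _; rewrite mulrBl. Qed.

Lemma dual_valueB l l' : dual_value l' - dual_value l =
  \sum_j (l' j - l j) * (b j - load (gibbs_plan l) j) -
  \sum_s gibbs_plan l s * (expR (potential l' s - potential l s) - 1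
                           - (potential l' s - potential l s)).
Proof.
under eq_bigr => j _ do rewrite mulrBr.
rewrite sumrB sum_mul_load.
have -> : \sum_s potential (fun j => l' j - l j) s * gibbs_plan l s =
          \sum_s (potential l' s - potential l s) * gibbs_plan l s.
  by apply: eq_bigr => s _; rewrite potentialB.
have -> : \sum_j (l' j - l j) * b j = \sum_j b j * l' j - \sum_j b j * l j.
  by rewrite -sumrB; apply: eq_bigr => j _; ring.
rewrite /dual_value; set B' := \sum_j b j * l' j; set B := \sum_j b j * l j.
have -> : \sum_s gibbs_plan l' s = \sum_s gibbs_plan l s *
    expR (potential l' s - potential l s).
  apply: eq_bigr => s _; rewrite /gibbs_plan -mulrA -expRD.
  by congr (_ * expR _); ring.
have -> : \sum_s gibbs_plan l s * (expR (potential l' s - potential l s) - 1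
      - (potential l' s - potential l s)) =
    \sum_s gibbs_plan l s * expR (potential l' s - potential l s)
    - \sum_s gibbs_plan l s
    - \sum_s (potential l' s - potential l s) * gibbs_plan l s.
  by rewrite -!sumrB; apply: eq_bigr => s _; ring.
by ring.
Qed.

Lemma admissible_load_le l x : admissible l ->
  (forall j, load x j <= b j) -> (forall j, e j -> load x j = b j) ->
  \sum_j b j * l j <= \sum_s potential l s * x s.
Proof.
move=> la xle xeq; rewrite -sum_mul_load; apply: ler_sum => j _.
rewrite mulrC; have [ej|ej] := boolP (e j); first by rewrite xeq.
by have := la j ej; have := xle j; nra.
Qed.

Lemma ler_norm_potential l s : `|potential l s| <= \sum_j `|l j|.
Proof.
apply: (le_trans (ler_norm_sum _ _ _)); apply: ler_sum => j _.
by rewrite normrM; case: (a j s); rewrite ?normr1 ?mulr1 // normr0 mulr0.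
Qed.

Lemma ler_norm_load x j : `|load x j| <= \sum_s `|x s|.
Proof.
apply: (le_trans (ler_norm_sum _ _ _)); apply: ler_sum => s _.
by rewrite normrM; case: (a j s); rewrite ?normr1 ?mul1r // normr0 mul0r.
Qed.

Lemma loadB x x' j : load x j - load x' j = load (fun s => x s - x' s) j.
Proof. by rewrite -sumrB; apply: eq_bigr => s _; rewrite mulrBr. Qed.

Hypothesis K_gt0 : forall s, 0 < K s.

Lemma gibbs_plan_gt0 l s : 0 < gibbs_plan l s.
Proof. by rewrite mulr_gt0 // expR_gt0. Qed.

Lemma stationary_eq l j : e j -> stationary l j -> load (gibbs_plan l) j = b j.
Proof.
move=> ej st; have nej (z : R) : ~~ e j -> z <= 0 by rewrite ej.
have := st _ (nej (l j + 1)); have := st _ (nej (l j - 1)).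
set r := load _ j => ? ?; apply/eqP; rewrite eq_le; apply/andP; split; lra.
Qed.

Lemma stationary_ineq l j : admissible l -> ~~ e j -> stationary l j ->
  load (gibbs_plan l) j <= b j /\ l j * (b j - load (gibbs_plan l) j) = 0.
Proof.
move=> la ej st; have lj := la j ej.
have /st h1 : ~~ e j -> l j - 1 <= 0 by move=> _; lra.
have /st h0 : ~~ e j -> (0 : R) <= 0 by [].
set r := b j - _ in h0 h1 *.
have r0 : 0 <= r by lra.
split; first by move: r0; rewrite subr_ge0.
by apply/eqP; rewrite eq_le; apply/andP; split; nra.
Qed.

Definition entropy x := \sum_s x s * (ln (x s) - ln (K s) - 1).

Lemma xlnx_gap (x y : R) : 0 <= x -> 0 < y ->
  x * (ln x - 1) - y * (ln y - 1) - (x - y) * ln y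
    >= (Num.sqrt x - Num.sqrt y) ^+ 2.
Proof.
move=> x0 y0; have [->|xn0] := eqVneq x 0.
  have -> : 0 * (ln 0 - 1) - y * (ln y - 1) - (0 - y) * ln y = y by ring.
  by rewrite sqrtr0 sub0r sqrrN sqr_sqrtr // ltW.
have {xn0} xp : 0 < x by rewrite lt_def xn0.
set p := Num.sqrt x; set q := Num.sqrt y.
have p0 : 0 < p by rewrite sqrtr_gt0.
have q0 : 0 < q by rewrite sqrtr_gt0.
have xE : x = p * p by rewrite -expr2 sqr_sqrtr.
have yE : y = q * q by rewrite -expr2 sqr_sqrtr // ltW.
have lx : ln x = 2 * ln p by rewrite xE lnM ?posrE //; ring.
have ly : ln y = 2 * ln q by rewrite yE lnM ?posrE //; ring.
have h : ln q - ln p <= q / p - 1.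
  rewrite -ln_div ?posrE //.
  have := @expR_ge1Dx R (ln (q / p)); rewrite lnK ?posrE ?divr_gt0 //; lra.
have h2 : x * (ln q - ln p) <= q * p - x.
  have -> : q * p - x = x * (q / p - 1) by rewrite xE; field; rewrite gt_eqF.
  by rewrite ler_pM2l.
rewrite lx ly; rewrite expr2; nra.
Qed.

(* Pythagorean inequality, with the Hellinger distance in place of the
   Kullback-Leibler divergence. *)
Lemma entropy_gap l x : admissible l -> (forall j, stationary l j) ->
  (forall s, 0 <= x s) -> (forall j, e j -> load x j = b j) ->
  (forall j, ~~ e j -> load x j <= b j) ->
  entropy (gibbs_plan l)
    + \sum_s (Num.sqrt (x s) - Num.sqrt (gibbs_plan l s)) ^+ 2 <= entropy x.
Proof.
move=> la st x0 xeq xle; set y := gibbs_plan l.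
have cs : 0 <= \sum_s potential l s * (x s - y s).
  rewrite -(sum_mul_load l (fun s => x s - y s)); apply: sumr_ge0 => j _.
  rewrite -loadB; have [ej|ej] := boolP (e j).
    by rewrite xeq // (stationary_eq ej (st j)) subrr mulr0.
  have [_] := stationary_ineq la ej (st j).
  by have := xle j ej; have := la j ej; rewrite -/y; nra.
suff : 0 <= \sum_s ((x s * (ln (x s) - ln (K s) - 1)
    - y s * (ln (y s) - ln (K s) - 1) - potential l s * (x s - y s))
    - (Num.sqrt (x s) - Num.sqrt (y s)) ^+ 2).
  by rewrite !sumrB -/(entropy x) -/(entropy y); lra.
apply: sumr_ge0 => s _; rewrite subr_ge0.
apply: (le_trans (xlnx_gap (x0 s) (gibbs_plan_gt0 l s))).
rewrite -/y; have -> : ln (y s) = ln (K s) + potential l s.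
  by rewrite /y lnM ?posrE ?expR_gt0 // expRK.
by rewrite le_eqVlt; apply/orP; left; apply/eqP; ring.
Qed.

End EntropicDuality.

(** * Linear convergence of cyclic block ascent *)

Section CyclicAscent.
Context {R : realType} {A J : finType}.
Variables (a : J -> A -> bool) (K : A -> R) (b : J -> R) (e : pred J).
Hypothesis K_gt0 : forall s, 0 < K s.

Variable x0 : A -> R.
Hypothesis x0_gt0 : forall s, 0 < x0 s.
Hypothesis x0_eq : forall j, e j -> load a x0 j = b j.
Hypothesis x0_le : forall j, load a x0 j <= b j.

Variable blk : J -> nat.
Hypothesis blk_disjoint : forall i j s, blk i = blk j -> a i s -> a j s -> i = j.

Variable lam : nat -> J -> R.
Hypothesis lam_admissible : forall k, admissible e (lam k).
Hypothesis lam_idle : forall k j, (forall s, ~~ a j s) -> lam k j = 0.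

(* The multipliers after the blocks of index less than [i] have been updated in
   the [k]-th sweep. *)
Definition mix k i j := if (blk j < i)%N then lam k.+1 j else lam k j.
Hypothesis lam_stationary : forall k j,
  stationary a K b e (mix k (blk j).+1) j.

Local Notation pot := (potential a).
Local Notation plan := (gibbs_plan a K).
Local Notation dual := (dual_value a K b).

Lemma mix_admissible k i : admissible e (mix k i).
Proof. by move=> j ej; rewrite /mix; case: ifP => _; exact: lam_admissible. Qed.

Lemma mix0 k : mix k 0 = lam k.
Proof. by apply: funext => j; rewrite /mix ltn0. Qed.

Lemma mix_end k i : (forall j, blk j < i)%N -> mix k i = lam k.+1.
Proof. by move=> h; apply: funext => j; rewrite /mix h. Qed.

Lemma dual_mix_step k i :
  dual (mix k i) + \sum_s plan (mix k i.+1) s *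
    (expR (pot (mix k i) s - pot (mix k i.+1) s) - 1
     - (pot (mix k i) s - pot (mix k i.+1) s)) <= dual (mix k i.+1).
Proof.
rewrite addrC -lerBrDr -lerN2 opprB dual_valueB gerDr.
apply: sumr_le0 => j _; have [ji|ji] := eqVneq (blk j) i; last first.
  by rewrite /mix ltnS [(blk j <= i)%N]leq_eqVlt (negbTE ji) /= subrr mul0r.
by rewrite -ji; apply: lam_stationary => ej; exact: mix_admissible.
Qed.

Lemma expR_sub_affine_ge0 (x : R) : 0 <= expR x - 1 - x.
Proof. by have := @expR_ge1Dx R x; lra. Qed.

Lemma dual_mix_le k i : dual (mix k i) <= dual (mix k i.+1).
Proof.
apply: le_trans (dual_mix_step k i); rewrite lerDl sumr_ge0 // => s _.
by rewrite mulr_ge0 ?expR_sub_affine_ge0 // ltW // gibbs_plan_gt0.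
Qed.

Lemma dual_mix_homo k i i' : (i <= i')%N -> dual (mix k i) <= dual (mix k i').
Proof.
move: i i'; apply: (@homo_leq _ (fun i => dual (mix k i)) <=%R).
- exact: lexx.
- by move=> ? ? ?; exact: le_trans.
- exact: dual_mix_le.
Qed.

Lemma dual_mix_ge k i : dual (lam k) <= dual (mix k i).
Proof. by rewrite -mix0; exact: dual_mix_homo. Qed.

Lemma dual_mix_le_next k i : dual (mix k i) <= dual (lam k.+1).
Proof.
rewrite -(@mix_end k (maxn i (\max_j blk j).+1)).
  by apply: dual_mix_homo; exact: leq_maxl.
by move=> j; rewrite leq_max ltnS leq_bigmax orbT.
Qed.

Lemma dual_homo k k' : (k <= k')%N -> dual (lam k) <= dual (lam k').
Proof.
move: k k'; apply: (@homo_leq _ (fun k => dual (lam k)) <=%R).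
- exact: lexx.
- by move=> ? ? ?; exact: le_trans.
- move=> n; exact: le_trans (dual_mix_ge n 0) (dual_mix_le_next n 0).
Qed.

Definition above l := admissible e l /\ dual (lam 0%N) <= dual l.

Lemma mix_above k i : above (mix k i).
Proof.
split; first exact: mix_admissible.
by apply: le_trans (dual_mix_ge k i); exact: dual_homo.
Qed.

Lemma lam_above k : above (lam k).
Proof. by rewrite -mix0; exact: mix_above. Qed.

(* Pairing with the strictly positive feasible plan makes the dual coercive in
   the potential (although not in the multipliers themselves). *)
Lemma dual_le_sum l : admissible e l ->
  \sum_s (K s * expR (pot l s) - x0 s * pot l s) <= - dual l.
Proof.
move=> la; rewrite sumrB /dual_value opprB lerB //.
under [leRHS]eq_bigr => s _ do rewrite mulrC.
exact: (admissible_load_le la x0_le x0_eq).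
Qed.

Lemma dual_bounded : exists G, forall l, admissible e l -> dual l <= G.
Proof.
have [c cP] := choice (fun s => expR_affine_lower (K_gt0 s) (x0_gt0 s)).
exists (- \sum_s c s) => l /dual_le_sum h.
by rewrite lerNr; apply: le_trans h; apply: ler_sum => s _; exact: cP.
Qed.

Lemma potential_bounded : exists2 L, 0 <= L &
  forall l, above l -> forall s, `|pot l s| <= L.
Proof.
have [c cP] := choice (fun s => expR_affine_lower (K_gt0 s) (x0_gt0 s)).
pose B s := - dual (lam 0%N) - (\sum_t c t - c s).
have [L LP] := choice (fun s => expR_affine_coercive (B s) (K_gt0 s) (x0_gt0 s)).
have [L0 L00 L0P] := finite_upper L.
exists L0 => // l [la ld] s; apply: le_trans (L0P s); apply: LP.
have := dual_le_sum la; rewrite (bigD1 s) //= => h.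
have : \sum_(t | t != s) c t <=
    \sum_(t | t != s) (K t * expR (pot l t) - x0 t * pot l t).
  by apply: ler_sum => t _; exact: cP.
by rewrite /B [\sum_t c t](bigD1 s) //=; lra.
Qed.

Lemma plan_bounds : exists y : R * R * R, [/\ 0 < y.1.1, 0 <= y.1.2, 0 <= y.2 &
  forall l, above l ->
    [/\ forall s, y.1.1 <= plan l s, forall s, `|pot l s| <= y.2 &
    forall l', above l' -> forall s,
      `|plan l s - plan l' s| <= y.1.2 * `|pot l s - pot l' s|]].
Proof.
have [L L0 LP] := potential_bounded.
have [km km0 kmP] := finite_pos_lower K_gt0.
have [kM kM0 kMP] := finite_upper K.
exists (km * expR (- L), kM * expR L, L); split => //=.
- by rewrite mulr_gt0 ?expR_gt0.
- by rewrite mulr_ge0 ?expR_ge0.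
move=> l lA; split; first 1 last.
- exact: LP.
- move=> l' lA' s; rewrite -mulrBr normrM -mulrA.
  apply: ler_pM => //; first by rewrite gtr0_norm.
  apply: expR_lipschitz; exact: le_trans (ler_norm _) (LP _ _ _).
- move=> s; apply: ler_pM; rewrite ?expR_ge0 ?(ltW km0) // ler_expR.
  by have := LP l lA s; rewrite ler_norml => /andP[].
Qed.

Lemma sqr_step_le : exists2 c, 0 < c & forall k j,
  (lam k.+1 j - lam k j) ^+ 2 <= c * (dual (lam k.+1) - dual (lam k)).
Proof.
have [[[yl yu] L] /= [yl0 _ L0 H]] := plan_bounds.
pose c := yl * (expR (- (L + L)) / 4).
have c0 : 0 < c by rewrite mulr_gt0 // divr_gt0 // expR_gt0.
exists c^-1 => [|k j]; first by rewrite invr_gt0.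
rewrite ler_pdivlMl //.
have dk : 0 <= dual (lam k.+1) - dual (lam k) by rewrite subr_ge0 dual_homo.
have [[s ajs]|nas] := pselect (exists s, a j s); last first.
  rewrite !lam_idle ?subrr ?expr0n ?mulr0 // => s;
  by apply/negP => ajs; apply: nas; exists s.
set i := blk j; pose h s := pot (mix k i) s - pot (mix k i.+1) s.
have hs : h s = lam k j - lam k.+1 j.
  rewrite /h -potentialB /potential (bigD1 j) //= big1.
    by rewrite ajs mulr1 addr0 /mix ltnn ltnSn.
  move=> t tj; have [ats|] := boolP (a t s); last by rewrite mulr0.
  have bt : blk t != i.
    by apply: contra tj => /eqP bt; apply/eqP; exact: blk_disjoint ats ajs.
  by rewrite /mix ltnS [(blk t <= i)%N]leq_eqVlt (negbTE bt) subrr mul0r.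
have hL : `|h s| <= L + L.
  have [_ p1 _] := H _ (mix_above k i); have [_ p2 _] := H _ (mix_above k i.+1).
  by apply: (le_trans (ler_normB _ _)); exact: lerD.
rewrite -sqrrN opprB -hs.
have : dual (mix k i.+1) - dual (mix k i) <= dual (lam k.+1) - dual (lam k).
  by rewrite lerB ?dual_mix_le_next ?dual_mix_ge.
apply: le_trans.
rewrite lerBrDl; apply: le_trans (dual_mix_step k i); rewrite lerD2l.
rewrite (bigD1 s) //= -/(h s); apply: (@le_trans _ _
  (plan (mix k i.+1) s * (expR (h s) - 1 - h s))).
  rewrite /c -mulrA; apply: ler_pM; rewrite ?(ltW yl0) //.
  - by rewrite mulr_ge0 ?sqr_ge0 // divr_ge0 // expR_ge0.
  - by have [+ _ _] := H _ (mix_above k i.+1); apply.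
  - exact: expR_quadratic_lower.
rewrite lerDl sumr_ge0 // => t _.
by rewrite mulr_ge0 ?expR_sub_affine_ge0 // ltW // gibbs_plan_gt0.
Qed.

Definition step k := \sum_j `|lam k.+1 j - lam k j|.

Lemma step_ge0 k : 0 <= step k.
Proof. by apply: sumr_ge0 => j _; exact: normr_ge0. Qed.

Lemma sqr_sum_step_le : exists2 c, 0 < c & forall k,
  step k ^+ 2 <= c * (dual (lam k.+1) - dual (lam k)).
Proof.
have [c c0 cP] := sqr_step_le.
exists (#|J|%:R ^+ 2 * c + 1) => [|k].
  by rewrite ltr_pwDr // mulr_ge0 ?sqr_ge0 // ltW.
set d := dual (lam k.+1) - dual (lam k).
have d0 : 0 <= d by rewrite subr_ge0 dual_homo.
have sq : step k <= #|J|%:R * Num.sqrt (c * d).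
  rewrite /step mulr_natl -sumr_const; apply: ler_sum => j _.
  by rewrite -sqrtr_sqr ler_wsqrtr //; exact: cP.
apply: (@le_trans _ _ ((#|J|%:R * Num.sqrt (c * d)) ^+ 2)).
  by rewrite lerXn2r ?nnegrE ?step_ge0 // mulr_ge0 ?ler0n ?sqrtr_ge0.
rewrite exprMn sqr_sqrtr ?mulr_ge0 ?(ltW c0) //.
by rewrite mulrDl mul1r mulrA lerDl.
Qed.

(* The residual that the later blocks leave at constraint [j] is of the order of
   the step of the sweep. *)
Lemma almost_stationary : exists2 c, 0 <= c & forall k j z,
  (~~ e j -> z <= 0) ->
  (z - lam k.+1 j) * (b j - load a (plan (lam k.+1)) j)
    <= c * step k * `|z - lam k.+1 j|.
Proof.
have [[[yl yu] L] /= [_ yu0 _ H]] := plan_bounds.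
exists (#|A|%:R * yu) => [|k j z zj]; first by rewrite mulr_ge0 ?ler0n.
set l := lam k.+1; set l' := mix k (blk j).+1.
have l'j : l' j = l j by rewrite /l' /mix ltnSn.
have := @lam_stationary k j z zj; rewrite -/l' l'j => st.
have : `|load a (plan l') j - load a (plan l) j| <= #|A|%:R * yu * step k.
  rewrite loadB; apply: (le_trans (ler_norm_load _ _ _)).
  rewrite -mulrA mulr_natl -sumr_const; apply: ler_sum => s _.
  have [_ _ +] := H _ (mix_above k (blk j).+1).
  move=> /(_ _ (lam_above k.+1) s) /le_trans; apply.
  rewrite ler_wpM2l // -potentialB; apply: (le_trans (ler_norm_potential _ _ _)).
  apply: ler_sum => t _; rewrite /mix; case: ifP => _.
    by rewrite subrr normr0 normr_ge0.
  by rewrite distrC.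
set m := load a _ j; set m' := load a _ j => mm.
rewrite (_ : b j - m' = (b j - m) + (m - m')); last by ring.
rewrite mulrDr -[leRHS]add0r; apply: lerD => //.
by rewrite mulrC; apply: (le_trans (ler_norm _)); rewrite normrM ler_wpM2r.
Qed.

Lemma dual_gap_le_sqr_step : exists2 c, 0 < c & forall k n, (k < n)%N ->
  dual (lam n) - dual (lam k.+1) <= c * step k ^+ 2.
Proof.
have [[[yl yu] L] /= [yl0 yu0 L0 H]] := plan_bounds.
have [c1 c10 c1P] := almost_stationary.
have [G GP] := dual_bounded.
pose M j (t : unit + A) : R := if t is inr s then (a j s)%:R else b j.
have [kap kap0 kapP] := hoffman_error_bound M.
pose c2 := yl * (expR (- (L + L)) / 4).
have c20 : 0 < c2 by rewrite mulr_gt0 // divr_gt0 // expR_gt0.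
pose c3 := c1 * kap; have c30 : 0 <= c3 by rewrite mulr_ge0.
pose c4 := c3 * (1 + yu); have c40 : 0 <= c4 by rewrite mulr_ge0 // addr_ge0.
pose Gm := G - dual (lam 0%N).
have Gm0 : 0 <= Gm by rewrite subr_ge0 GP.
pose c5 := #|A|%:R * (c4 ^+ 2 / (4 * c2)).
have c50 : 0 <= c5.
  by rewrite mulr_ge0 ?ler0n // divr_ge0 ?sqr_ge0 // mulr_ge0 // ltW.
exists (2 * c5 + 4 * Gm * c3 ^+ 2 + 1) => [|k n kn].
  rewrite ltr_pwDr // addr_ge0 //; first by lra.
  by apply: mulr_ge0; [lra|exact: sqr_ge0].
set l := lam k.+1; set z := lam n; set sg := step k.
have sg0 : 0 <= sg by exact: step_ge0.
have [la lz] : above l /\ above z by split; exact: lam_above.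
have [w [wbox wM wk]] := kapP l z.
have wA j : ~~ e j -> w j <= 0.
  move=> ej; have /andP[_] := wbox j; rewrite le_max.
  by have := lam_admissible k.+1 ej; have := lam_admissible n ej;
     rewrite -/l -/z => ? ? /orP[] ?; lra.
have potw s : pot w s = pot z s by exact: (wM (inr s)).
have planw s : plan w s = plan z s by rewrite /gibbs_plan potw.
have dualw : dual w = dual z.
  have := wM (inl tt); rewrite /M /= => bw.
  rewrite /dual_value; congr (_ - _); last by apply: eq_bigr => s _; exact: planw.
  under eq_bigr => j _ do rewrite mulrC.
  by rewrite bw; apply: eq_bigr => j _; rewrite mulrC.
set g := dual z - dual l.
have g0 : 0 <= g by rewrite subr_ge0; apply: dual_homo.
have gGm : g <= Gm by apply: lerB; [apply: GP; case: lz|case: la].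
pose h s := pot z s - pot l s; pose Hs : R := \sum_s `|h s|.
have Hs0 : 0 <= Hs by apply: sumr_ge0 => s _; exact: normr_ge0.
have wl : \sum_j `|w j - l j| <= kap * (g + (1 + yu) * Hs).
  apply: (le_trans wk); rewrite ler_wpM2l // /residual big_sumType /=.
  rewrite (big_pred1 tt) => [|[]//]; rewrite /M /= mulrDl mul1r addrA [leRHS]addrAC.
  apply: lerD; last first.
    by apply: ler_sum => s _; rewrite /h -potentialB.
  have -> : \sum_j (z j - l j) * b j = g + \sum_s (plan z s - plan l s).
    rewrite /g /dual_value sumrB.
    under eq_bigr => j _ do rewrite mulrC mulrBr.
    by rewrite sumrB; ring.
  apply: (le_trans (ler_normD _ _)); rewrite ger0_norm // lerD2l.
  apply: (le_trans (ler_norm_sum _ _ _)); rewrite mulr_sumr.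
  by apply: ler_sum => s _; have [_ _] := H _ lz; apply.
have key : g + c2 * \sum_s h s ^+ 2 <= c3 * sg * g + \sum_s c4 * sg * `|h s|.
  have := dual_valueB a K b l w; rewrite dualw -/g => gE; rewrite [X in X + _ <= _]gE.
  rewrite -addrA [leRHS](_ : _ = c1 * sg * (kap * (g + (1 + yu) * Hs))); last first.
    by rewrite -mulr_sumr -/Hs /c4 /c3; ring.
  rewrite -[leRHS]addr0; apply: lerD.
    apply: (@le_trans _ _ (\sum_j c1 * sg * `|w j - l j|)).
      by apply: ler_sum => j _; apply: c1P; exact: wA.
    by rewrite -mulr_sumr ler_wpM2l // mulr_ge0.
  rewrite addrC subr_le0 mulr_sumr; apply: ler_sum => s _.
  have [pl pL _] := H _ la; have [_ pL' _] := H _ lz.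
  rewrite potw -/(h s) /c2 -mulrA; apply: ler_pM; rewrite ?(ltW yl0) //.
    by rewrite mulr_ge0 ?sqr_ge0 // divr_ge0 // expR_ge0.
  apply: expR_quadratic_lower; apply: (le_trans (ler_normB _ _)).
  by apply: lerD; [exact: pL'|exact: pL].
have amgm s : c4 * sg * `|h s| <= c2 * h s ^+ 2 + c4 ^+ 2 / (4 * c2) * sg ^+ 2.
  rewrite -subr_ge0 -(real_normK (num_real (h s))).
  rewrite (_ : _ - _ = c2 * (`|h s| - c4 * sg / (2 * c2)) ^+ 2).
    by rewrite mulr_ge0 ?sqr_ge0 // ltW.
  by field; rewrite gt_eqF.
have {}key : g <= c3 * sg * g + c5 * sg ^+ 2.
  have : \sum_s c4 * sg * `|h s| <= c2 * (\sum_s h s ^+ 2) + c5 * sg ^+ 2.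
    rewrite (_ : c5 * sg ^+ 2 = \sum_(s : A) c4 ^+ 2 / (4 * c2) * sg ^+ 2).
      by rewrite mulr_sumr -big_split /=; apply: ler_sum => s _; exact: amgm.
    by rewrite /c5 -mulrA mulr_natl -sumr_const; apply: eq_bigr.
  lra.
rewrite !mulrDl mul1r; have sq0 := sqr_ge0 sg.
have t1 : 0 <= c5 * sg ^+ 2 by rewrite mulr_ge0.
have t2 : 0 <= Gm * c3 ^+ 2 * sg ^+ 2 by rewrite !mulr_ge0 ?sqr_ge0.
have [small|big] := leP (c3 * sg) (1 / 2).
  have : c3 * sg * g <= 1 / 2 * g by rewrite ler_wpM2r.
  by lra.
have : Gm * 1 <= Gm * (4 * (c3 * sg) ^+ 2).
  by rewrite ler_wpM2l // expr2; nra.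
by rewrite mulr1 exprMn; lra.
Qed.

Lemma dual_gap_contracts : exists2 c, 0 < c & forall k n, (k < n)%N ->
  dual (lam n) - dual (lam k.+1) <= c * (dual (lam k.+1) - dual (lam k)).
Proof.
have [c1 c10 h1] := dual_gap_le_sqr_step; have [c2 c20 h2] := sqr_sum_step_le.
exists (c1 * c2) => [|k n kn]; first exact: mulr_gt0.
by apply: (le_trans (h1 k n kn)); rewrite -mulrA ler_pM2l.
Qed.

Lemma step_geometric : exists C r, [/\ 0 <= C, 0 < r < 1 &
  forall k, step k <= C * r ^+ k].
Proof.
have [c c0 h] := dual_gap_contracts; have [c2 c20 h2] := sqr_sum_step_le.
have [G GP] := dual_bounded.
set G0 := G - dual (lam 0%N); have G00 : 0 <= G0 by rewrite subr_ge0 GP.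
have gap := geometric_gap c0 h (fun n => lerB (GP _ (lam_admissible n)) (lexx _)).
set q := c / (1 + c) in gap.
have q0 : 0 < q by rewrite divr_gt0 // addr_gt0.
have q1 : q < 1 by rewrite ltr_pdivrMr ?addr_gt0 // mul1r ltrDr.
exists (Num.sqrt (c2 * G0)), (Num.sqrt q); split.
- exact: sqrtr_ge0.
- by rewrite sqrtr_gt0 q0 -[ltRHS]sqrtr1 ltr_sqrt.
move=> k; rewrite -[leLHS](ger0_norm (step_ge0 k)) -sqrtr_sqr.
have -> : Num.sqrt q ^+ k = Num.sqrt (q ^+ k).
  elim: k => [|k IH]; first by rewrite !expr0 sqrtr1.
  by rewrite exprS IH [in RHS]exprS (sqrtrM _ (ltW q0)).
rewrite -sqrtrM ?mulr_ge0 ?(ltW c20) // ler_wsqrtr //.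
apply: (le_trans (h2 k)); rewrite -mulrA ler_pM2l //.
exact: gap.
Qed.

Theorem cyclic_ascent_linear : exists l C r,
  [/\ 0 <= C, 0 < r < 1, admissible e l, forall j, stationary a K b e l j &
   forall k s, `|plan (lam k) s - plan l s| <= C * r ^+ k].
Proof.
have [C [r [C0 /andP[r0 r1] hstep]]] := step_geometric.
have r01 : 0 <= r < 1 by rewrite (ltW r0).
have B0 : 0 <= C / (1 - r) by rewrite divr_ge0 // subr_ge0 ltW.
set B := C / (1 - r) in B0.
have [l lP] : exists l : J -> R, forall j k, `|lam k j - l j| <= B * r ^+ k.
  suff /choice[l lP] : forall j, exists x, forall k, `|lam k j - x| <= B * r ^+ k.
    by exists l.
  move=> j; apply: geometric_cauchy => // k; apply: le_trans (hstep k).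
  by rewrite /step (bigD1 j) //= lerDl sumr_ge0.
clearbody B; have la : admissible e l.
  move=> j ej; apply: (le0_of_geometric r01 (C := B)) => k.
  have := lam_admissible k ej; have := lP j k; rewrite ler_norml => /andP[+ _].
  by lra.
have [L L0 LP] := potential_bounded.
have [kM kM0 kMP] := finite_upper K.
have potlim k s : `|pot (lam k) s - pot l s| <= #|J|%:R * B * r ^+ k.
  rewrite -potentialB; apply: (le_trans (ler_norm_potential _ _ _)).
  by rewrite -mulrA mulr_natl -sumr_const; apply: ler_sum.
have potL s : pot l s <= L.
  rewrite -subr_le0; apply: (le0_of_geometric r01 (C := #|J|%:R * B)) => k.
  have := potlim k s; have := LP _ (lam_above k) s.
  by rewrite !ler_norml => /andP[_ ?] /andP[? _]; lra.
set D := kM * expR L * (#|J|%:R * B).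
have D0 : 0 <= D by rewrite !mulr_ge0 ?expR_ge0.
have planlim k s : `|plan (lam k) s - plan l s| <= D * r ^+ k.
  rewrite -mulrBr normrM /D -!mulrA; apply: ler_pM => //.
    by rewrite gtr0_norm.
  apply: (le_trans (expR_lipschitz _ (potL s))).
    by apply: (le_trans (ler_norm _)); exact: LP (lam_above k) s.
  by rewrite ler_pM2l ?expR_gt0 // mulrA.
exists l, D, r; split => //; first by rewrite r0.
have [c c0 hc] := almost_stationary.
move=> j z zj; set rl := b j - load a (plan l) j.
set E := #|A|%:R * D; have E0 : 0 <= E by rewrite mulr_ge0.
have loadlim k : `|load a (plan l) j - load a (plan (lam k)) j| <= E * r ^+ k.
  rewrite loadB; apply: (le_trans (ler_norm_load _ _ _)).
  rewrite /E -mulrA mulr_natl -sumr_const; apply: ler_sum => s _.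
  by rewrite distrC.
set F := c * C * (`|z - l j| + B) + B * `|rl| + (`|z - l j| + B) * E.
apply: (le0_of_geometric r01 (C := F)) => k.
have := hc k j z zj.
set p := r ^+ k; set lk := lam k.+1 j; set rk := b j - _ => hk.
have p0 : 0 <= p by rewrite exprn_ge0 // ltW.
have p1 : r ^+ k.+1 <= p by rewrite exprS ler_piMl // ltW.
have hl : `|lk - l j| <= B * p.
  by apply: (le_trans (lP j k.+1)); rewrite ler_wpM2l.
have hl1 : `|lk - l j| <= B.
  apply: (le_trans hl); rewrite ler_piMr // /p exprn_ile1 // ltW //.
have hr : `|rl - rk| <= E * p.
  rewrite (_ : rl - rk = - (load a (plan l) j - load a (plan (lam k.+1)) j)).
    by rewrite normrN; apply: (le_trans (loadlim _)); rewrite ler_wpM2l.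
  by rewrite /rl /rk; ring.
have hz : `|z - lk| <= `|z - l j| + B.
  rewrite (_ : z - lk = (z - l j) - (lk - l j)); last by ring.
  by apply: (le_trans (ler_normB _ _)); rewrite lerD2l.
rewrite (_ : (z - l j) * rl =
  (z - lk) * rk + (lk - l j) * rl + (z - lk) * (rl - rk)); last by ring.
have t1 : (z - lk) * rk <= c * C * (`|z - l j| + B) * p.
  rewrite (_ : _ * p = c * (C * p) * (`|z - l j| + B)); last by ring.
  apply: (le_trans hk); apply: ler_pM; rewrite ?mulr_ge0 ?step_ge0 //.
  by rewrite ler_wpM2l.
have t2 : (lk - l j) * rl <= B * `|rl| * p.
  apply: (le_trans (ler_norm _)); rewrite normrM mulrAC.
  by rewrite ler_wpM2r.
have t3 : (z - lk) * (rl - rk) <= (`|z - l j| + B) * E * p.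
  by apply: (le_trans (ler_norm _)); rewrite normrM -mulrA ler_pM.
by rewrite /F 2!mulrDl; lra.
Qed.

End CyclicAscent.

(** * The path-wise problem as an entropic problem *)

Section Reduction.
Context {R : realType} (G : network R).
Local Notation V := (node G).
Local Notation T := 'I_(ntimes G).

Definition schedules (p : routes G) : finType := schedule (ntimes G) (val p).
Definition entry : finType := {p : routes G & schedules p}.

Definition route_of (x : entry) : route V := val (tag x).
Definition times_of (x : entry) : schedule (ntimes G) (route_of x) := tagged x.
Definition mass_at (pi : plan G) (x : entry) : R := pi (tag x) (tagged x).

Definition active (x : entry) : bool :=
  [&& (path_cost (times_of x) < +oo)%E,
      0 < mu0 (times_of x ord0) (src (route_of x)) &
      0 < muT (times_of x ord_max) (snk (route_of x))].

Definition active_entry : finType := {x : entry | active x}.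

(* Departures from, arrivals at, and crossings of a node at a given time. *)
Definition constraint : finType := ((V * T) + ((V * T) + (V * T)))%type.

Definition covers (j : constraint) (x : entry) : bool :=
  match j with
  | inl (v, i) => (src (route_of x) == v) && (times_of x ord0 == i)
  | inr (inl (v, i)) => (snk (route_of x) == v) && (times_of x ord_max == i)
  | inr (inr (v, i)) => [exists l : pos (route_of x),
       [&& inner l, vertex l == v & times_of x l == i]]
  end.

Definition total (pi : plan G) (j : constraint) : R :=
  \sum_x (covers j x)%:R * mass_at pi x.

Lemma vertex_inj (p : routes G) : injective (@vertex V (val p)).
Proof.
move=> l l'; rewrite /vertex => /eqP.
have /and4P[_ _ _ u] := routesP (valP p).
by rewrite !(tnth_nth (src (val p))) nth_uniq ?size_tuple // => /eqP /val_inj.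
Qed.

Lemma sum_inner_pos (p : routes G) (t : schedule (ntimes G) (val p)) v i (c : R) :
  \sum_(l : pos (val p) | [&& inner l, vertex l == v & t l == i]) c =
  (covers (inr (inr (v, i))) (Tagged schedules (t : schedules p)))%:R * c.
Proof.
rewrite /covers; case: existsP => /= [[l /and3P[il /eqP vl /eqP tl]]|h].
  rewrite mul1r (big_pred1 l) // => l' /=; apply/idP/eqP => [|->].
    by move=> /and3P[_ /eqP vl' _]; apply: vertex_inj; rewrite vl vl'.
  by rewrite il vl tl !eqxx.
by rewrite mul0r big_pred0 // => l; apply/negP => hl; apply: h; exists l.
Qed.

Lemma departuresE pi v i : departures pi v i = total pi (inl (v, i)).
Proof.
rewrite /departures /marginal.
rewrite (sig_big_dep (fun p : routes G => src (val p) == v)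
  (fun (p : routes G) (t : schedules p) => t ord0 == i) (fun p t => pi p t)).
rewrite big_mkcond; apply: eq_bigr => x _.
by rewrite /covers /route_of /times_of; case: ifP => _; rewrite ?mul1r ?mul0r.
Qed.

Lemma arrivalsE pi v i : arrivals pi v i = total pi (inr (inl (v, i))).
Proof.
rewrite /arrivals /marginal.
rewrite (sig_big_dep (fun p : routes G => snk (val p) == v)
  (fun (p : routes G) (t : schedules p) => t ord_max == i) (fun p t => pi p t)).
rewrite big_mkcond; apply: eq_bigr => x _.
by rewrite /covers /route_of /times_of; case: ifP => _; rewrite ?mul1r ?mul0r.
Qed.

Lemma crossingsE pi v i : crossings pi v i = total pi (inr (inr (v, i))).
Proof.
rewrite /crossings /marginal /total.
transitivity (\sum_(p : routes G) \sum_(t : schedules p)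
   (covers (inr (inr (v, i))) (Tagged schedules t))%:R * pi p t).
  apply: eq_bigr => p _.
  rewrite (exchange_big_dep xpredT) //=; apply: eq_bigr => t _.
  rewrite -sum_inner_pos; apply: eq_bigl => l; rewrite andbA //.
rewrite (sig_big_dep xpredT (fun _ => xpredT) (fun p (t : schedules p) =>
  (covers (inr (inr (v, i))) (Tagged schedules t))%:R * pi p t)).
by apply: eq_bigr => -[p t] _.
Qed.

Lemma total_gt0 pi j x : (forall y, 0 <= mass_at pi y) ->
  covers j x -> 0 < mass_at pi x -> 0 < total pi j.
Proof.
move=> pi0 cx px; rewrite /total (bigD1 x) //= cx mul1r.
by rewrite ltr_wpDr // sumr_ge0 // => y _; rewrite mulr_ge0.
Qed.

Lemma total_eq0 pi j x : (forall y, 0 <= mass_at pi y) ->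
  total pi j = 0 -> covers j x -> mass_at pi x = 0.
Proof.
move=> pi0 t0 cx; apply/eqP; rewrite eq_le pi0 andbT leNgt; apply/negP => px.
by have := total_gt0 pi0 cx px; rewrite t0 ltxx.
Qed.

Definition vanishes (pi : plan G) := forall x, ~~ active x -> mass_at pi x = 0.

Definition restricted (pi : plan G) (x : active_entry) := mass_at pi (val x).

Definition incidence (j : constraint) (x : active_entry) := covers j (val x).

Lemma sum_active (F : entry -> R) : (forall x, ~~ active x -> F x = 0) ->
  \sum_x F x = \sum_(x : active_entry) F (val x).
Proof.
move=> F0; rewrite -(big_sub [pred x | active x]) /= [RHS]big_mkcond /=.
by apply: eq_bigr => x _; rewrite inE; case: ifP => // /negbT /F0.
Qed.

Lemma total_load pi j : vanishes pi -> total pi j = load incidence (restricted pi) j.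
Proof. by move=> pi0; apply: sum_active => x /pi0 ->; rewrite mulr0. Qed.

Definition supported (j : constraint) : bool := [exists x, incidence j x].

Lemma unsupported_load (y : active_entry -> R) j :
  ~~ supported j -> load incidence y j = 0.
Proof.
move=> /existsPn h; apply: big1 => x _.
by rewrite (negbTE (h x)) mul0r.
Qed.

Definition binding (j : constraint) : bool :=
  supported j && (if j is inr (inr _) then false else true).

Definition bound (j : constraint) : R :=
  match j with
  | inl (v, i) => if supported j then mu0 i v else 0
  | inr (inl (v, i)) => if supported j then muT i v else 0
  | inr (inr (v, i)) => rate i v
  end.

Definition kernel (x : active_entry) : R := gibbs (times_of (val x)).

Lemma src_route (p : routes G) : src (val p) \in sources G.
Proof. by have /and4P[] := routesP (valP p). Qed.

Lemma snk_route (p : routes G) : snk (val p) \in sinks G.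
Proof. by have /and4P[] := routesP (valP p). Qed.

Lemma supported_src v i : supported (inl (v, i)) -> v \in sources G /\ 0 < mu0 i v.
Proof.
move=> /existsP[[x /= ax]] /andP[/eqP <- /eqP <-].
by split; [exact: src_route|case/and3P: ax].
Qed.

Lemma supported_snk v i :
  supported (inr (inl (v, i))) -> v \in sinks G /\ 0 < muT i v.
Proof.
move=> /existsP[[x /= ax]] /andP[/eqP <- /eqP <-].
by split; [exact: snk_route|case/and3P: ax].
Qed.

Definition route_cost (x : entry) : R := fine (path_cost (times_of x)).

Lemma path_cost_fin (p : route V) (t : schedule (ntimes G) p) :
  (path_cost t < +oo)%E -> path_cost t = (fine (path_cost t))%:E.
Proof. by rewrite /path_cost; case: ifP. Qed.

Lemma path_cost_infty (p : route V) (t : schedule (ntimes G) p) :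
  ~~ (path_cost t < +oo)%E -> path_cost t = +oo%E.
Proof. by rewrite /path_cost; case: ifP => //; rewrite ltry. Qed.

Lemma gibbs_infty (p : route V) (t : schedule (ntimes G) p) :
  ~~ (path_cost t < +oo)%E -> gibbs t = 0.
Proof.
move=> /path_cost_infty h; rewrite /gibbs h gt0_mulye ?lte_fin ?invr_gt0 ?eps_gt0 //.
Qed.

Lemma gibbs_fin (p : route V) (t : schedule (ntimes G) p) :
  (path_cost t < +oo)%E -> gibbs t = expR (- (fine (path_cost t) / eps G)).
Proof. by move=> /path_cost_fin h; rewrite /gibbs h. Qed.

Lemma gibbs_ge0 (p : route V) (t : schedule (ntimes G) p) : 0 <= gibbs t.
Proof.
have [h|h] := boolP (path_cost t < +oo)%E; last by rewrite gibbs_infty.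
by rewrite gibbs_fin // expR_ge0.
Qed.

Lemma kernel_gt0 x : 0 < kernel x.
Proof.
by have /and3P[h _ _] := valP x; rewrite /kernel gibbs_fin // expR_gt0.
Qed.

Lemma feasible_mass_ge0 pi : feasible pi -> forall x, 0 <= mass_at pi x.
Proof. by move=> [pi0 _ _ _] x; exact: pi0. Qed.

Lemma feasible_vanishes pi : feasible pi ->
  (forall x, ~~ (path_cost (times_of x) < +oo)%E -> mass_at pi x = 0) ->
  vanishes pi.
Proof.
move=> piF inf0 x; rewrite /active; have pi0 := feasible_mass_ge0 piF.
have [_ dep arr _] := piF.
have [_ /=|h _] := boolP (path_cost (times_of x) < +oo)%E; last exact: inf0.
set i := times_of x ord0; set i' := times_of x ord_max.
rewrite negb_and => /orP[h|h].
  have := dep _ i (src_route (tag x)); rewrite departuresE => h0.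
  apply: (total_eq0 pi0 (j := inl (src (route_of x), i))); last by rewrite /= !eqxx.
  rewrite h0; apply/eqP; rewrite eq_le mu0_ge0 ?src_route // andbT leNgt.
  exact: h.
have := arr _ i' (snk_route (tag x)); rewrite arrivalsE => h0.
apply: (total_eq0 pi0 (j := inr (inl (snk (route_of x), i')))); last first.
  by rewrite /= !eqxx.
rewrite h0; apply/eqP; rewrite eq_le muT_ge0 ?snk_route // andbT leNgt.
exact: h.
Qed.

Lemma binding_load pi j : feasible pi -> vanishes pi -> binding j ->
  load incidence (restricted pi) j = bound j.
Proof.
move=> [_ dep arr _] piv; rewrite -total_load // /binding.
case: j => [[v i]|[[v i]|[v i]]]; rewrite ?andbF ?andbT //= => sj; rewrite sj.
  by rewrite -departuresE dep //; case: (supported_src sj).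
by rewrite -arrivalsE arr //; case: (supported_snk sj).
Qed.

Lemma load_le_bound pi j : feasible pi -> vanishes pi ->
  load incidence (restricted pi) j <= bound j.
Proof.
move=> piF piv; have [bj|nbj] := boolP (binding j); first by rewrite binding_load.
have [_ _ _ cr] := piF.
case: j nbj => [[v i]|[[v i]|[v i]]]; rewrite /binding ?andbT /=.
- by move=> nsj; rewrite unsupported_load // (negbTE nsj).
- by move=> nsj; rewrite unsupported_load // (negbTE nsj).
- by move=> _; rewrite -total_load // -crossingsE.
Qed.

Lemma objective_finite pi : vanishes pi ->
  objective pi = (eps G * entropy kernel (restricted pi))%:E.
Proof.
move=> piv; pose F (x : entry) := (route_cost x
  + eps G * (ln (mass_at pi x) - 1)) * mass_at pi x.
transitivity (\sum_(x : entry) (F x)%:E)%E.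
  rewrite /objective (sig_big_dep xpredT (fun _ => xpredT)
    (fun p (t : schedules p) => (path_cost t + (eps G * (ln (pi p t) - 1))%:E)
                               * (pi p t)%:E)%E) /=.
  apply: eq_bigr => x _.
  have [h|h] := boolP (path_cost (times_of x) < +oo)%E.
    by rewrite -[path_cost _]/(path_cost (times_of x)) (path_cost_fin h).
  have px : pi (tag x) (tagged x) = 0 by apply: piv; rewrite /active (negbTE h).
  by rewrite /F /mass_at px mule0 mulr0.
rewrite sumEFin sum_active => [|x /piv px]; last by rewrite /F px mulr0.
congr (_%:E); rewrite /entropy mulr_sumr; apply: eq_bigr => x _.
have /and3P[h _ _] := valP x.
rewrite /F /restricted /kernel gibbs_fin // expRK /route_cost.
by field; rewrite gt_eqF // eps_gt0.
Qed.

Lemma objective_infty pi x : (forall x, 0 <= mass_at pi x) ->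
  ~~ (path_cost (times_of x) < +oo)%E -> mass_at pi x != 0 ->
  objective pi = +oo%E.
Proof.
move=> pi0 cx px; rewrite /objective (sig_big_dep xpredT (fun _ => xpredT)
    (fun p (t : schedules p) => (path_cost t + (eps G * (ln (pi p t) - 1))%:E)
                               * (pi p t)%:E)%E) /=.
apply/eqP; rewrite esum_eqy; last first.
  move=> y _; have [h|h] := boolP (path_cost (times_of y) < +oo)%E.
    by rewrite -[path_cost _]/(path_cost (times_of y)) (path_cost_fin h).
  rewrite -[path_cost _]/(path_cost (times_of y)) (path_cost_infty h) addye //.
  have := pi0 y; rewrite /mass_at le_eqVlt => /orP[/eqP <-|p0].
    by rewrite mule0.
  by rewrite gt0_mulye.
apply/existsP; exists x => /=.
rewrite -[path_cost _]/(path_cost (times_of x)) (path_cost_infty cx) addye //.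
by rewrite gt0_mulye // lte_fin lt_def px pi0.
Qed.

End Reduction.

(** * The projections as block updates *)

Section Sweeps.
Context {R : realType} (G : network R).
Local Notation V := (node G).
Local Notation T := 'I_(ntimes G).
Implicit Types s : scaling G.

Definition scal s (j : constraint G) : R :=
  match j with
  | inl (v, i) => su s v i
  | inr (inl (v, i)) => sv s v i
  | inr (inr (v, i)) => sw s v i
  end.

(* The scaling of an unsupported constraint does not affect the plan, and may
   vanish; it is ignored. *)
Definition multiplier s j := if supported j then ln (scal s j) else 0.

Definition proper s := [/\ forall v i, v \in sources G -> 0 <= su s v i,
  forall v i, v \in sinks G -> 0 <= sv s v i,
  forall v i, 0 < sw s v i <= 1 &
  forall j, supported j -> 0 < scal s j].

Definition src_null s := forall v i, v \in sources G ->
  ~~ (0 < mu0 i v) -> su s v i = 0.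
Definition snk_null s := forall v i, v \in sinks G ->
  ~~ (0 < muT i v) -> sv s v i = 0.
Definition settled s := [/\ proper s, src_null s & snk_null s].

Lemma mass_srcE s v i : mass_src s v i = total (scaled_plan s) (inl (v, i)).
Proof.
rewrite -departuresE; apply: eq_bigr => p /eqP <-.
rewrite /flux_src /marginal mulr_sumr; apply: eq_bigr => t /eqP <-.
by rewrite /scaled_plan; ring.
Qed.

Lemma mass_snkE s v i : mass_snk s v i = total (scaled_plan s) (inr (inl (v, i))).
Proof.
rewrite -arrivalsE; apply: eq_bigr => p /eqP <-.
rewrite /flux_snk /marginal mulr_sumr; apply: eq_bigr => t /eqP <-.
by rewrite /scaled_plan; ring.
Qed.

Lemma mass_innerE s v i :
  mass_inner s v i = total (scaled_plan s) (inr (inr (v, i))).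
Proof.
rewrite -crossingsE; apply: eq_bigr => p _; apply: eq_bigr => l /andP[il /eqP <-].
rewrite /flux_inner /marginal mulr_sumr; apply: eq_bigr => t /eqP <-.
by rewrite /scaled_plan [\prod_(_ | inner _) _](bigD1 l) //=; ring.
Qed.

Lemma active_supported (x : entry G) j : active x -> covers j x -> supported j.
Proof. by move=> ax cx; apply/existsP; exists (exist _ x ax). Qed.

Lemma active_scal_gt0 s (x : entry G) : proper s -> active x ->
  0 < su s (src (route_of x)) (times_of x ord0) /\
  0 < sv s (snk (route_of x)) (times_of x ord_max).
Proof.
move=> [_ _ _ pos] ax; split.
  apply: (pos (inl (src (route_of x), times_of x ord0))).
  by apply: active_supported ax _; rewrite /= !eqxx.
apply: (pos (inr (inl (snk (route_of x), times_of x ord_max)))).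
by apply: active_supported ax _; rewrite /= !eqxx.
Qed.

Lemma scaled_mass_ge0 s : proper s -> forall x, 0 <= mass_at (scaled_plan s) x.
Proof.
move=> [u0 v0 w0 _] [p t]; rewrite /mass_at /scaled_plan /=.
rewrite !mulr_ge0 ?gibbs_ge0 ?u0 ?v0 ?src_route ?snk_route //.
by apply: prodr_ge0 => l _; have /andP[/ltW] := w0 (vertex l) (t l).
Qed.

Lemma scaled_mass_gt0 s : proper s -> forall x, active x ->
  0 < mass_at (scaled_plan s) x.
Proof.
move=> sp x ax; have [u0 v0] := active_scal_gt0 sp ax.
have [_ _ w0 _] := sp; have /and3P[cx _ _] := ax.
rewrite /mass_at /scaled_plan !mulr_gt0 //.
- by rewrite (gibbs_fin (t := times_of x)) // expR_gt0.
- by apply: prodr_gt0 => l _; have /andP[] := w0 (vertex l) (times_of x l).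
Qed.

Lemma settled_vanishes s : settled s -> vanishes (scaled_plan s).
Proof.
move=> [sp s0 t0] [p t]; rewrite /active /mass_at /scaled_plan /times_of /=.
have [cx|cx _] := boolP (path_cost _ < +oo)%E; last first.
  by rewrite gibbs_infty // !mul0r.
rewrite andTb negb_and => /orP[h|h].
  by rewrite (s0 _ _ (src_route p) h) mulr0 !mul0r.
by rewrite (t0 _ _ (snk_route p) h) mulr0.
Qed.

Lemma supported_total_gt0 s j : proper s -> supported j ->
  0 < total (scaled_plan s) j.
Proof.
move=> sp /existsP[[x /= ax]] cx.
exact: total_gt0 (scaled_mass_ge0 sp) cx (scaled_mass_gt0 sp ax).
Qed.

(* Each path crosses a node at most once, so that the scaling of a constraint
   enters the mass of an entry with exponent 0 or 1. *)
Lemma scaled_planE s : proper s ->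
  restricted (scaled_plan s) = gibbs_plan (@incidence _ G) (@kernel _ G) (multiplier s).
Proof.
move=> sp; apply: funext => y; have ay : active (val y) := valP y.
have [u0 v0] := active_scal_gt0 sp ay; have [_ _ w0 _] := sp.
have multE j : incidence j y -> multiplier s j = ln (scal s j).
  by move=> cy; rewrite /multiplier (active_supported ay cy).
set t := times_of (val y); set p := route_of (val y).
have pick1 (F : V * T -> R) (w : V * T) (Q : pred (V * T)) :
    (forall w', Q w' = (w == w')) -> \sum_w' F w' * (Q w')%:R = F w.
  move=> Qw; rewrite (bigD1 w) //= Qw eqxx mulr1 big1 ?addr0 // => w' w'w.
  by rewrite Qw eq_sym (negbTE w'w) mulr0.
have src_sum : \sum_w multiplier s (inl w) * (incidence (inl w) y)%:R =
    ln (su s (src p) (t ord0)).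
  rewrite (pick1 (fun w => multiplier s (inl w)) (src p, t ord0)
                 (fun w => incidence (inl w) y)).
    by rewrite multE //= /incidence /= !eqxx.
  by move=> [v i].
have snk_sum : \sum_w multiplier s (inr (inl w)) * (incidence (inr (inl w)) y)%:R =
    ln (sv s (snk p) (t ord_max)).
  rewrite (pick1 (fun w => multiplier s (inr (inl w))) (snk p, t ord_max)
                 (fun w => incidence (inr (inl w)) y)).
    by rewrite multE //= /incidence /= !eqxx.
  by move=> [v i].
have inner_sum :
    \sum_w multiplier s (inr (inr w)) * (incidence (inr (inr w)) y)%:R =
    \sum_(l : pos p | inner l) ln (sw s (vertex l) (t l)).
  rewrite [RHS](partition_big (fun l : pos p => (vertex l, t l)) xpredT) //=.
  apply: eq_bigr => -[v i] _.
  transitivity (\sum_(l : pos p | [&& inner l, vertex l == v & t l == i])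
      multiplier s (inr (inr (v, i)))).
    by rewrite sum_inner_pos mulrC; congr (_%:R * _); rewrite /incidence; case: (val y).
  apply: eq_big => [l|l /and3P[il /eqP vl /eqP tl]]; first by rewrite xpair_eqE.
  rewrite multE /= ?vl ?tl //; apply/existsP; exists l.
  by rewrite il vl -tl !eqxx.
rewrite /gibbs_plan /potential !big_sumType /= src_sum snk_sum inner_sum.
rewrite !expRD expR_sum (lnK u0) (lnK v0).
have -> : \prod_(l : pos p | inner l) expR (ln (sw s (vertex l) (t l))) =
    \prod_(l : pos p | inner l) sw s (vertex l) (t l).
  by apply: eq_bigr => l _; rewrite lnK // posrE; case/andP: (w0 (vertex l) (t l)).
rewrite /restricted /mass_at /scaled_plan /kernel; ring.
Qed.

Lemma proper_project_src s : proper s ->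
  proper (project_src s) /\ src_null (project_src s).
Proof.
move=> sp; have [u0 v0 w0 pos] := sp; split; first split => //.
- move=> v i vs /=; rewrite mulr_ge0 ?u0 // divr_ge0 ?mu0_ge0 // mass_srcE.
  by apply: sumr_ge0 => x _; rewrite mulr_ge0 // scaled_mass_ge0.
- move=> [[v i]|j] sj; last by case: j sj => [[v i]|[v i]] sj; exact: (pos _ sj).
  have [vs mu] := supported_src sj.
  rewrite /= mulr_gt0 ?(pos _ sj) // divr_gt0 // mass_srcE.
  exact: supported_total_gt0.
- move=> v i vs mu /=; have -> : mu0 i v = 0; last by rewrite mul0r mulr0.
  by apply/eqP; rewrite eq_le mu0_ge0 // andbT leNgt.
Qed.

Lemma proper_project_snk s : proper s ->
  proper (project_snk s) /\ snk_null (project_snk s).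
Proof.
move=> sp; have [u0 v0 w0 pos] := sp; split; first split => //.
- move=> v i vs /=; rewrite mulr_ge0 ?v0 // divr_ge0 ?muT_ge0 // mass_snkE.
  by apply: sumr_ge0 => x _; rewrite mulr_ge0 // scaled_mass_ge0.
- move=> [[v i]|[[v i]|[v i]]] sj; try exact: (pos _ sj).
  have [vs mu] := supported_snk sj.
  rewrite /= mulr_gt0 ?(pos _ sj) // divr_gt0 // mass_snkE.
  exact: supported_total_gt0.
- move=> v i vs mu /=; have -> : muT i v = 0; last by rewrite mul0r mulr0.
  by apply/eqP; rewrite eq_le muT_ge0 // andbT leNgt.
Qed.

Lemma mass_inner_ge0 s v i : proper s -> 0 <= mass_inner s v i.
Proof.
move=> sp; rewrite mass_innerE; apply: sumr_ge0 => x _.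
by rewrite mulr_ge0 // scaled_mass_ge0.
Qed.

Lemma proper_project_capacity s v : proper s -> proper (project_capacity s v).
Proof.
move=> sp; have [u0 v0 w0 pos] := sp.
have wP y i : 0 < sw (project_capacity s v) y i <= 1.
  rewrite /=; case: eqP => // _; case: eqP => [_|/eqP m0]; first by rewrite ltr01 lexx.
  have mg : 0 < mass_inner s v i by rewrite lt_def m0 mass_inner_ge0.
  rewrite ge_min lexx orbT andbT lt_min ltr01 andbT mulr_gt0 //.
    by case/andP: (w0 v i).
  by rewrite divr_gt0 // rate_gt0.
split => // -[[y i]|[[y i]|[y i]]] sj; try exact: (pos _ sj).
by case/andP: (wP y i).
Qed.

Lemma settled_project_src s : settled s -> settled (project_src s).
Proof. by move=> [/proper_project_src[? ?] _ ?]. Qed.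

Lemma settled_project_snk s : settled s -> settled (project_snk s).
Proof. by move=> [/proper_project_snk[? ?] ? _]. Qed.

Lemma settled_foldl s ns : settled s -> settled (foldl (@project_capacity _ G) s ns).
Proof.
elim: ns s => //= v ns IH s [sp su0 sv0]; apply: IH; split => //.
exact: proper_project_capacity.
Qed.

Lemma multiplier_admissible s : proper s -> admissible (@binding _ G) (multiplier s).
Proof.
move=> [_ _ w0 _] j; rewrite /binding /multiplier; case: (supported j) => //=.
case: j => [//|[//|[v i]]] _ /=; apply: ln_le0; by case/andP: (w0 v i).
Qed.

Local Notation stationary_at s j :=
  (stationary (@incidence _ G) (@kernel _ G) (@bound _ G) (@binding _ G)
     (multiplier s) j).

Lemma settled_load s j : settled s ->
  load (@incidence _ G) (gibbs_plan (@incidence _ G) (@kernel _ G) (multiplier s)) j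
  = total (scaled_plan s) j.
Proof.
move=> ss; have [sp _ _] := ss.
by rewrite -scaled_planE // total_load //; exact: settled_vanishes.
Qed.

Lemma unsupported_stationary s j : ~~ supported j -> stationary_at s j.
Proof.
move=> nsj z; rewrite /binding (negbTE nsj) /= => /(_ isT) z0.
rewrite unsupported_load // /multiplier (negbTE nsj) !subr0.
case: j nsj => [[v i]|[[v i]|[v i]]] nsj; rewrite /= ?(negbTE nsj) ?mulr0 //.
by rewrite mulr_le0_ge0 // ltW // rate_gt0.
Qed.

Lemma total_bound_stationary s j : settled s ->
  total (scaled_plan s) j = bound j -> stationary_at s j.
Proof. by move=> ss tb z _; rewrite settled_load // tb subrr mulr0. Qed.

Lemma mass_project_src s v i :
  mass_src (project_src s) v i = mu0 i v / mass_src s v i * mass_src s v i.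
Proof.
rewrite [in LHS]/mass_src [X in _ * X]/mass_src mulr_sumr.
by apply: eq_bigr => p _; rewrite mulrCA mulrA.
Qed.

Lemma mass_project_snk s v i :
  mass_snk (project_snk s) v i = muT i v / mass_snk s v i * mass_snk s v i.
Proof.
rewrite [in LHS]/mass_snk [X in _ * X]/mass_snk mulr_sumr.
by apply: eq_bigr => p _; rewrite mulrCA mulrA.
Qed.

Lemma mass_project_capacity s v i : sw s v i != 0 ->
  mass_inner (project_capacity s v) v i =
  sw (project_capacity s v) v i / sw s v i * mass_inner s v i.
Proof.
move=> w0; rewrite /mass_inner mulr_sumr; apply: eq_bigr => p _.
rewrite mulr_sumr; apply: eq_bigr => l /andP[il /eqP vl].
rewrite mulrA divfK //; congr (_ * _); apply: eq_bigr => t _; congr (_ * _).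
apply: eq_bigr => l' /andP[_ ll'] /=; case: eqP => // vl'.
by case/eqP: ll'; apply: vertex_inj; rewrite vl vl'.
Qed.

Lemma project_src_stationary s v i : settled s ->
  stationary_at (project_src s) (inl (v, i)).
Proof.
move=> ss; have [sj|] := boolP (supported (inl (v, i) : constraint G)); last first.
  exact: unsupported_stationary.
apply: total_bound_stationary; first exact: settled_project_src.
rewrite -mass_srcE mass_project_src divfK /= ?sj // mass_srcE gt_eqF //.
by apply: supported_total_gt0 => //; case: ss.
Qed.

Lemma project_snk_stationary s v i : settled s ->
  stationary_at (project_snk s) (inr (inl (v, i))).
Proof.
move=> ss; have [sj|] := boolP (supported (inr (inl (v, i)) : constraint G));
  last exact: unsupported_stationary.
apply: total_bound_stationary; first exact: settled_project_snk.
rewrite -mass_snkE mass_project_snk divfK /= ?sj // mass_snkE gt_eqF //.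
by apply: supported_total_gt0 => //; case: ss.
Qed.

Lemma project_capacity_stationary s v i : settled s ->
  stationary_at (project_capacity s v) (inr (inr (v, i))).
Proof.
move=> ss; have [sj|] := boolP (supported (inr (inr (v, i)) : constraint G));
  last exact: unsupported_stationary.
have ss' := @settled_foldl s [:: v] ss; rewrite /= in ss'.
have [sp _ _] := ss; have [_ _ w0 _] := sp.
have wv : 0 < sw s v i by case/andP: (w0 v i).
have m0 : 0 < mass_inner s v i by rewrite mass_innerE supported_total_gt0.
have := @mass_project_capacity s v i; rewrite gt_eqF // => /(_ isT).
set w' := sw _ v i => mE.
have w'E : w' = Num.min (sw s v i * (rate i v / mass_inner s v i)) 1.
  by rewrite /w' /= eqxx gt_eqF.
move: w'E; rewrite minElt; case: ifP => [_|/negbT w'1] w'E.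
  apply: total_bound_stationary => //; rewrite -mass_innerE mE w'E /=.
  by field; rewrite !gt_eqF.
move=> z; rewrite settled_load // -mass_innerE mE /binding andbF => /(_ isT) z0.
rewrite /multiplier sj [scal _ _]w'E ln1 subr0 w'E mul1r mulr_le0_ge0 //.
move: w'1; rewrite -leNgt mulrA ler_pdivlMr // mul1r subr_ge0 => h.
by rewrite ler_pdivrMl.
Qed.

End Sweeps.

(** * The trajectory and its limit *)

Section Trajectory.
Context {R : realType} (G : network R).
Variable nodes : seq (node G).
Hypothesis nodesP : perm_eq nodes (enum (node G)).
Local Notation state k := (iter k (sweep nodes) (init_scaling G)).

Definition partial_sweep i (s : scaling G) : scaling G :=
  match i with
  | 0%N => s
  | 1%N => project_src s
  | i.+2 => foldl (@project_capacity R G) (project_snk (project_src s)) (take i nodes)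
  end.

Definition block (j : constraint G) : nat :=
  match j with
  | inl _ => 0
  | inr (inl _) => 1
  | inr (inr (v, _)) => (index v nodes).+2
  end.

Lemma mem_nodes v : v \in nodes.
Proof. by rewrite (perm_mem nodesP) mem_enum. Qed.

Lemma nodes_uniq : uniq nodes.
Proof. by rewrite (perm_uniq nodesP) enum_uniq. Qed.

Lemma index_nodes_inj : injective (index^~ nodes).
Proof.
move=> v w vw.
by rewrite -(nth_index v (mem_nodes v)) vw (nth_index v (mem_nodes w)).
Qed.

Lemma block_disjoint i j x : block i = block j ->
  incidence i x -> incidence j x -> i = j.
Proof.
case: i => [[v i]|[[v i]|[v i]]]; case: j => [[w j]|[[w j]|[w j]]] //=.
- by move=> _ /andP[/eqP <- /eqP <-] /andP[/eqP <- /eqP <-].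
- by move=> _ /andP[/eqP <- /eqP <-] /andP[/eqP <- /eqP <-].
- move=> [/index_nodes_inj <-] /existsP[l /and3P[_ /eqP lv /eqP <-]].
  move=> /existsP[l' /and3P[_ /eqP lv' /eqP <-]].
  by have -> // : l = l'; apply: vertex_inj; rewrite lv lv'.
Qed.

Lemma su_foldl (s : scaling G) ns : su (foldl (@project_capacity R G) s ns) = su s.
Proof. by elim: ns s => //= v ns IH s; rewrite IH. Qed.

Lemma sv_foldl (s : scaling G) ns : sv (foldl (@project_capacity R G) s ns) = sv s.
Proof. by elim: ns s => //= v ns IH s; rewrite IH. Qed.

Lemma sw_foldl (s : scaling G) ns v : v \notin ns ->
  sw (foldl (@project_capacity R G) s ns) v = sw s v.
Proof.
elim: ns s => //= w ns IH s; rewrite inE negb_or => /andP[vw /IH ->].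
by apply: funext => i /=; rewrite (negbTE vw).
Qed.

Lemma scal_partial_sweep i s j :
  scal (partial_sweep i s) j =
  if (block j < i)%N then scal (sweep nodes s) j else scal s j.
Proof.
case: i => [|[|i]]; case: j => [[v t]|[[v t]|[v t]]] //=.
- by rewrite /sweep su_foldl.
- by rewrite su_foldl /sweep su_foldl.
- by rewrite sv_foldl /sweep sv_foldl.
rewrite !ltnS -(in_take _ (mem_nodes v)); case: ifP => [vi|/negbT vi].
  rewrite /sweep -[in RHS](cat_take_drop i nodes) foldl_cat [in RHS]sw_foldl //.
  have := nodes_uniq; rewrite -{1}(cat_take_drop i nodes) cat_uniq.
  by case/and3P=> _ /hasPn h _; apply/negP => /h; rewrite /= vi.
by rewrite sw_foldl.
Qed.

Lemma multiplier_partial_sweep i s : multiplier (partial_sweep i s) =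
  fun j => if (block j < i)%N then multiplier (sweep nodes s) j else multiplier s j.
Proof.
apply: funext => j; rewrite /multiplier scal_partial_sweep.
by case: (supported j); case: ifP.
Qed.

Lemma settled_sweep s : proper s -> settled (sweep nodes s).
Proof.
move=> sp; have [sp1 su1] := proper_project_src sp.
by have [sp2 sv2] := proper_project_snk sp1; apply: settled_foldl.
Qed.

Lemma proper_init : proper (init_scaling G).
Proof.
split => [v i _|v i _|v i|[[v i]|[[v i]|[v i]]] _] /=;
by rewrite ?ltr01 ?lexx.
Qed.

Lemma settled_state k : settled (state k.+1).
Proof.
elim: k => [|k IH]; first exact: settled_sweep proper_init.
by rewrite iterS; apply: settled_sweep; case: IH.
Qed.

Lemma partial_sweep_stationary s j : settled s ->
  stationary (@incidence R G) (@kernel R G) (@bound R G) (@binding R G)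
    (multiplier (partial_sweep (block j).+1 s)) j.
Proof.
move=> ss; case: j => [[v i]|[[v i]|[v i]]].
- exact: project_src_stationary.
- rewrite /= take0; apply: project_snk_stationary; exact: settled_project_src.
rewrite /= (take_nth v) ?index_mem ?mem_nodes // nth_index ?mem_nodes //.
rewrite foldl_rcons; apply: project_capacity_stationary; apply: settled_foldl.
by apply: settled_project_snk; exact: settled_project_src.
Qed.

End Trajectory.

Section Optimality.
Context {R : realType} (G : network R).
Variable l : constraint G -> R.
Hypothesis l_admissible : admissible (@binding _ G) l.
Hypothesis l_stationary : forall j,
  stationary (@incidence _ G) (@kernel _ G) (@bound _ G) (@binding _ G) l j.
Local Notation optimum := (gibbs_plan (@incidence _ G) (@kernel _ G) l).

Definition extended : plan G := fun p t =>
  if insub (Tagged (@schedules _ G) (t : schedules p)) is Some x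
  then optimum x else 0.

Lemma mass_at_extended x :
  mass_at extended x = if insub x is Some y then optimum y else 0.
Proof. by case: x. Qed.

Lemma restricted_extended : restricted extended = optimum.
Proof.
by apply: funext => x; rewrite /restricted mass_at_extended valK.
Qed.

Lemma extended_vanishes : vanishes extended.
Proof. by move=> x nax; rewrite mass_at_extended insubN. Qed.

Lemma extended_feasible (pi : plan G) : feasible pi -> vanishes pi ->
  feasible extended.
Proof.
move=> [_ dep arr _] piv; have ev := extended_vanishes; split.
- move=> p t; rewrite /extended; case: insubP => // x _ _.
  by rewrite ltW // gibbs_plan_gt0 //; exact: kernel_gt0.
- move=> v i vs; rewrite departuresE total_load // restricted_extended.
  have [sj|nsj] := boolP (supported (inl (v, i) : constraint G)).
    by rewrite (stationary_eq _ (@l_stationary _)) /= ?sj // /binding sj.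
  by rewrite -dep // departuresE total_load // !unsupported_load.
- move=> v i vs; rewrite arrivalsE total_load // restricted_extended.
  have [sj|nsj] := boolP (supported (inr (inl (v, i)) : constraint G)).
    by rewrite (stationary_eq _ (@l_stationary _)) /= ?sj // /binding sj.
  by rewrite -arr // arrivalsE total_load // !unsupported_load.
- move=> v i; rewrite crossingsE total_load // restricted_extended.
  have nb : ~~ binding (inr (inr (v, i)) : constraint G) by rewrite /binding andbF.
  by have [] := stationary_ineq l_admissible nb (@l_stationary _).
Qed.

Lemma objective_extended_gap (pi : plan G) : feasible pi -> vanishes pi ->
  (objective extended + (eps G * \sum_x
     (Num.sqrt (restricted pi x) - Num.sqrt (optimum x)) ^+ 2)%:E <= objective pi)%E.
Proof.
move=> piF piv; rewrite !objective_finite //; last exact: extended_vanishes.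
rewrite restricted_extended -EFinD lee_fin -mulrDr ler_pM2l ?eps_gt0 //.
apply: (entropy_gap (@kernel_gt0 _ G) l_admissible (@l_stationary)) => [x|j bj|j _].
- exact: feasible_mass_ge0.
- exact: binding_load.
- exact: load_le_bound.
Qed.

Lemma feasible_dichotomy (pi : plan G) : feasible pi ->
  vanishes pi \/ objective pi = +oo%E.
Proof.
move=> piF; have pi0 := feasible_mass_ge0 piF.
have [h|] := pselect (forall x,
    ~~ (path_cost (times_of x) < +oo)%E -> mass_at pi x = 0).
  by left; exact: feasible_vanishes.
move=> /existsNP[x] /not_implyP[cx /eqP px]; right; exact: objective_infty cx px.
Qed.

Lemma extended_unique_optimal : feasible extended ->
  unique (optimal (G := G)) extended.
Proof.
move=> eF; split; first split => // pi piF.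
  have [piv|->] := feasible_dichotomy piF; last by rewrite leey.
  apply: le_trans (objective_extended_gap piF piv).
  rewrite leeDl // lee_fin mulr_ge0 ?(ltW (eps_gt0 G)) // sumr_ge0 // => x _.
  exact: sqr_ge0.
move=> pi [piF /(_ _ eF)]; have [piv|->] := feasible_dichotomy piF; last first.
  by rewrite objective_finite //; exact: extended_vanishes.
move=> le_pi; have := le_trans (objective_extended_gap piF piv) le_pi.
rewrite objective_finite; last exact: extended_vanishes.
rewrite -EFinD lee_fin gerDl pmulr_rle0 ?eps_gt0 // => sum_le0.
have sq_ge0 x : true -> 0 <= (Num.sqrt (restricted pi x) - Num.sqrt (optimum x)) ^+ 2.
  by move=> _; exact: sqr_ge0.
have /(psumr_eq0P sq_ge0) eq0 : \sum_x
    (Num.sqrt (restricted pi x) - Num.sqrt (optimum x)) ^+ 2 = 0.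
  by apply/eqP; rewrite eq_le sum_le0 sumr_ge0.
have eq_restr x : restricted pi x = optimum x.
  have /eqP := eq0 x isT; rewrite sqrf_eq0 subr_eq0 => /eqP sq.
  rewrite -[LHS]sqr_sqrtr ?feasible_mass_ge0 // sq sqr_sqrtr //.
  by rewrite ltW // gibbs_plan_gt0 //; exact: kernel_gt0.
have eq_mass x : mass_at extended x = mass_at pi x.
  rewrite mass_at_extended; case: insubP => [y _ <-|/piv -> //].
  by rewrite -eq_restr.
apply: functional_extensionality_dep => p; apply: funext => t.
exact: (eq_mass (Tagged (@schedules _ G) (t : schedules p))).
Qed.

End Optimality.

Theorem theorem5 (R : realType) (G : network R) (nodes : seq (node G))
  (nodesP : perm_eq nodes (enum (node G))) (slater : strictly_feasible G) :
  exists pi : plan G,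
    unique (optimal (G := G)) pi /\
    converges_linearly (sinkhorn_plan nodes) pi.
Proof.
case: slater => pi0 pi0F pi0_gt0.
have pi0v : vanishes pi0.
  move=> x nax; apply/eqP; rewrite eq_le feasible_mass_ge0 // andbT leNgt.
  by rewrite /mass_at pi0_gt0.
have pi0_pos (x : active_entry G) : 0 < restricted pi0 x.
  by rewrite /restricted /mass_at pi0_gt0; exact: (valP x).
pose st k := iter k (sweep nodes) (init_scaling G).
have stS k : settled (st k.+1) by exact: settled_state.
pose lam k := multiplier (st k.+1).
have [|||l [C [r [C0 r01 la lst lC]]]] := @cyclic_ascent_linear _ _ _
  (@incidence R G) (@kernel R G) (@bound R G) (@binding R G) (@kernel_gt0 R G)
  (restricted pi0) pi0_pos (fun j => binding_load pi0F pi0v)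
  (fun j => load_le_bound j pi0F pi0v) (block nodes) (block_disjoint nodesP) lam.
- by move=> k; apply: multiplier_admissible; case: (stS k).
- move=> k j nj; rewrite /lam /multiplier ifN //.
  by apply/existsPn => x; exact: nj.
- move=> k j; have := @partial_sweep_stationary R G nodes nodesP (st k.+1) j (stS k).
  by rewrite multiplier_partial_sweep.
have /andP[r0 _] := r01.
exists (extended l); split.
  exact/extended_unique_optimal/(extended_feasible la lst pi0F).
pose D x := `|mass_at (sinkhorn_plan nodes 0) x - mass_at (extended l) x|.
have [B B0 BP] := finite_upper D.
exists (B + C / r), r; split => // [|k p t].
  by rewrite addr_ge0 // divr_ge0 // ltW.
pose x : entry G := Tagged (@schedules _ G) (t : schedules p).
change (`|mass_at (sinkhorn_plan nodes k) x - mass_at (extended l) x|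
  <= (B + C / r) * r ^+ k).
case: k => [|k].
  by rewrite expr0 mulr1 (le_trans (BP x)) // lerDl divr_ge0 // ltW.
have Crk : C / r * r ^+ k.+1 = C * r ^+ k by rewrite exprS mulrA divfK // gt_eqF.
rewrite mulrDl Crk; apply: ler_wpDl; first by rewrite mulr_ge0 // exprn_ge0 // ltW.
have [ax|nax] := boolP (active x); last first.
  rewrite (settled_vanishes (stS k)) // extended_vanishes // subrr normr0.
  by rewrite mulr_ge0 // exprn_ge0 // ltW.
have := lC k (exist _ x ax); have [stp _ _] := stS k.
by rewrite /lam -scaled_planE // -restricted_extended.
Qed.
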